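(* There exist a finitely generated group $\Gamma$ of asymptotic dimension $2$ and a finitely generated group $\Lambda$ of infinite asymptotic dimension that admit an $(\exp,\exp)$-integrable orbit equivalence coupling.
   Context: An orbit equivalence coupling from $\Gamma=\langle S_\Gamma\rangle$ to $\Lambda=\langle S_\Lambda\rangle$ ($S_\Gamma,S_\Lambda$ finite symmetric) is a standard probability space $(X,\mu)$ with free (up to null sets) measure-preserving actions of $\Gamma$ and $\Lambda$ such that $\Gamma\cdot x=\Lambda\cdot x$ for almost every $x\in X$. For $y\in\Lambda\cdot x$, $d_{S_\Lambda}(x,y)$ is the minimal word length of $\lambda\in\Lambda$ with $y=\lambda\cdot x$; $d_{S_\Gamma}$ is defined similarly. The coupling is $(\exp,\exp)$-integrable if for all $\gamma\in\Gamma$ and $\lambda\in\Lambda$ there are $c_\gamma,c_\lambda>0$ such that $\int_X\exp\left(d_{S_\Lambda}(x,\gamma\cdot x)/c_\gamma\right)d\mu(x)<\infty$ and $\int_X\exp\left(d_{S_\Gamma}(x,\lambda\cdot x)/c_\lambda\right)d\mu(x)<\infty$. *)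

(* Defs.v *)
From HB Require Import structures.
From mathcomp Require Import all_boot all_order all_algebra.
From mathcomp Require Import all_classical all_reals all_analysis.

Set Implicit Arguments.
Unset Strict Implicit.
Unset Printing Implicit Defensive.

Import Order.TTheory GRing.Theory Num.Theory.
Import numFieldNormedType.Exports.

Local Open Scope classical_set_scope.
Local Open Scope ring_scope.

Definition words (G : groupType) (S : set G) (g : G) : set (seq G) :=
  [set w | (forall s, s \in w -> S s) /\ (\prod_(s <- w) s)%g = g].

Definition finite_symmetric_generating (G : groupType) (S : set G) : Prop :=
  [/\ finite_set S,
      forall s, S s -> S (s^-1)%g &
      forall g, words S g !=set0].

(* [ereal_inf set0 = +oo], but the infimum is a minimum, hence a natural
   number, as soon as [S] generates. *)
Definition word_length (R : realType) (G : groupType) (S : set G) (g : G)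
    : \bar R :=
  ereal_inf [set (size w)%:R%:E | w in words S g].

Definition word_dist (R : realType) (G : groupType) (S : set G) (g h : G)
    : \bar R :=
  word_length R S (g^-1 * h)%g.

(* Gromov's definition: for every scale [r], the space is covered by [n.+1]
   families of uniformly bounded sets, each family being [r]-disjoint. *)
Definition asdim_le (R : realType) (T : Type) (d : T -> T -> \bar R) (n : nat)
    : Prop :=
  forall r : R, 0 < r ->
  exists (U : 'I_n.+1 -> set (set T)) (D : R),
  [/\ forall x, exists i A, U i A /\ A x,
      forall i A x y, U i A -> A x -> A y -> (d x y <= D%:E)%E &
      forall i A B x y, U i A -> U i B -> A <> B -> A x -> B y ->
        (r%:E < d x y)%E].

(* [+oo] when no [n] is suitable. *)
Definition asdim (R : realType) (T : Type) (d : T -> T -> \bar R) : \bar R :=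
  ereal_inf [set n%:R%:E | n in asdim_le d].

(* The sigma-algebra is, up to a bijection, the Borel sigma-algebra of a Polish
   space. *)
Definition standard_borel (R : realType) (d : measure_display)
    (X : measurableType d) : Prop :=
  exists (P : completePseudoMetricType R) (f : X -> P),
  [/\ hausdorff_space P, @second_countable P, bijective f &
      forall A : set X, measurable A <-> <<s [set O : set P | open O] >> (f @` A)].

Definition is_group_action (G : groupType) (X : Type) (a : G -> X -> X) : Prop :=
  (forall x, a 1%g x = x) /\ (forall g h x, a (g * h)%g x = a g (a h x)).

Definition measure_preserving (R : realType) (d : measure_display)
    (X : measurableType d) (mu : probability X R) (f : X -> X) : Prop :=
  measurable_fun [set: X] f /\
  forall A : set X, measurable A -> mu (f @^-1` A) = mu A.

Definition orbit_of (G : groupType) (X : Type) (a : G -> X -> X) (x : X) : set X :=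
  [set a g x | g in [set: G]].

Definition free_pmp_action (R : realType) (d : measure_display)
    (X : measurableType d) (mu : probability X R) (G : groupType)
    (a : G -> X -> X) : Prop :=
  [/\ is_group_action a,
      forall g, measure_preserving mu (a g) &
      {ae mu, forall x, forall g, a g x = x -> g = 1%g}].

Definition orbit_equivalence_coupling (R : realType) (d : measure_display)
    (X : measurableType d) (mu : probability X R) (G L : groupType)
    (aG : G -> X -> X) (aL : L -> X -> X) : Prop :=
  [/\ standard_borel R X,
      free_pmp_action mu aG,
      free_pmp_action mu aL &
      {ae mu, forall x, orbit_of aG x = orbit_of aL x}].

(* [+oo] when [y] is not in the orbit of [x]. *)
Definition orbit_dist (R : realType) (G : groupType) (S : set G) (X : Type)
    (a : G -> X -> X) (x y : X) : \bar R :=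
  ereal_inf [set word_length R S g | g in [set g | y = a g x]].

(* Integrability, in the direction of the acting group [G], of the distances
   measured along the orbits of [H]. *)
Definition exp_integrable (R : realType) (d : measure_display)
    (X : measurableType d) (mu : probability X R) (G H : groupType)
    (SH : set H) (aG : G -> X -> X) (aH : H -> X -> X) : Prop :=
  forall g : G, exists2 c : R, 0 < c &
  (\int[mu]_x expeR (orbit_dist R SH aH x (aG g x) * (c^-1)%:E) < +oo)%E.

Definition exp_exp_integrable (R : realType) (d : measure_display)
    (X : measurableType d) (mu : probability X R) (G L : groupType)
    (SG : set G) (SL : set L) (aG : G -> X -> X) (aL : L -> X -> X) : Prop :=
  exp_integrable mu SL aG aL /\ exp_integrable mu SG aL aG.

(* Main.v *)
Require Import Defs.
From HB Require Import structures.
From mathcomp Require Import all_boot all_order all_algebra perm.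
From mathcomp Require Import all_classical all_reals all_analysis.
From mathcomp Require Import measurable_realfun zify lra.

(** Let [X = {0,1}^(Z^2)] with the fair Bernoulli measure.  The two shifts of
    [X] together with the flip of the bit at the origin generate the lamplighter
    group [Z/2 wr Z^2]; replacing the flip by the odometer that adds [1] with
    carry along the column [{(0, j) | j >= 0}], they generate
    [(sum_Z Z[1/2]) x| Z^2], one shift acting on [Z[1/2]] as the multiplication
    by [2].  A flip is the odometer or its inverse, and the odometer flips
    finitely many bits unless a carry runs forever, so the orbits agree almost
    everywhere; the length of the carry has a geometric distribution, which
    gives the exponential integrability.

    The lamplighter group is [Z^2] up to locally finite pieces, hence has
    asymptotic dimension [2], whereas the odometers of distinct columns generate
    a free abelian group of infinite rank.  That [Z^m] has asymptotic dimension
    at least [m] is a form of the Lebesgue covering theorem, obtained from a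
    parity count on Kuhn's triangulation of the cube. *)

Set Implicit Arguments.
Unset Strict Implicit.
Unset Printing Implicit Defensive.

Import Order.TTheory GRing.Theory Num.Theory.

(** * A labelling lemma on Kuhn's triangulation of the cube *)

(** The two groups share their shifts and differ in a single generator, so orbits and distances are
    compared for that generator only. Replacing flips by odometers preserves the length of a word at
    every point, so one half of the integrability is a uniform bound. Conversely, imitating a carry
    over [n] digits by flips costs [3 * n + 1] letters, because the origin has to travel along the
    column and back, while such a carry has probability of order [2^-n]. A cost linear in the carry
    against an exponentially small probability gives one generator an exponential moment; the
    triangle inequality along a word and the invariance of the measure pass it on to the whole
    group.

    Both groups are taken inside the bijections of [X], which makes the actions faithful; freeness
    is the real issue. A translation part is excluded by the aperiodicity of almost every
    configuration, and the abelian part acts freely because it is continuous with dense orbits. All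
    null sets are gathered in the complement of the single set [good]. *)

(** Composition with a transposition exchanges even and odd permutations, so the sum is twice its
    odd half. *)
Lemma odd_sum_swap (m : nat) (F : 'S_m -> nat) (a b : 'I_m) :
  a != b -> (forall s, F (s * tperm a b)%g = F s) -> odd (\sum_s F s) = false.
Proof.
move=> ab Fab; rewrite (bigID (fun s : 'S_m => odd_perm s)) /=.
have -> : \sum_(s : 'S_m | ~~ odd_perm s) F s = \sum_(s : 'S_m | odd_perm s) F s.
  rewrite (reindex_inj (mulIg (tperm a b))) /=; apply: eq_big => s.
    by rewrite odd_permM odd_tperm ab addbT negbK.
  by rewrite Fab.
by rewrite addnn odd_double.
Qed.

Section Kuhn.
Variables (n M : nat).
Notation m := n.+1.
Notation pt := {ffun 'I_m -> nat}.
Variable lab : pt -> 'I_m * bool.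

(* The Kuhn simplex based at [v] is a path from [v] to [v + 1]; [s i] is the step
   at which the coordinate [i] is increased. *)
Definition kuhn_vertex (v : 'I_m -> nat) (s : 'S_m) (k : nat) : pt :=
  [ffun i => v i + (s i < k)].

(* The facet omitting the vertex [k] carries all the positive labels. *)
Definition door (v : 'I_m -> nat) (s : 'S_m) (k : nat) : bool :=
  [forall c, exists j : 'I_m.+1, (j != k :> nat) && (lab (kuhn_vertex v s j) == (c, true))].

Definition neighbours (x y : pt) := forall i, x i <= y i <= (x i).+1.

Hypothesis no_antipodal : forall x y b c,
  neighbours x y -> lab x = (c, b) -> lab y = (c, ~~ b) -> False.

Lemma kuhn_vertex_neighbours v s j k :
  j <= k -> neighbours (kuhn_vertex v s j) (kuhn_vertex v s k).
Proof. by move=> jk i; rewrite !ffunE; lia. Qed.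

(** A door omitting [k0] matches the [m] other vertices with the [m] positive labels. The label of
    [k0] is then positive too, since a negative one would be antipodal to a vertex of the door; it
    repeats the label of one vertex [f c0], and the doors are those omitting [k0] or [f c0]. *)
Lemma doors_even v s : odd (\sum_(k < m.+1) door v s k) = false.
Proof.
case: (pickP (fun k : 'I_m.+1 => door v s k)) => [k0 dk0|nod]; last first.
  by rewrite big1 // => k _; rewrite nod.
pose L (j : 'I_m.+1) := lab (kuhn_vertex v s j).
have antip (j k : 'I_m.+1) c : L j = (c, true) -> L k = (c, false) -> False.
  rewrite /L => Lj Lk; case: (leqP j k) => jk.
    exact: (no_antipodal (kuhn_vertex_neighbours v s jk) Lj Lk).
  exact: (no_antipodal (kuhn_vertex_neighbours v s (ltnW jk)) Lk Lj).
have /fin_all_exists[f Hf] : forall c, exists j : 'I_m.+1, (j != k0) /\ L j = (c, true).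
  by move=> c; have /forallP/(_ c)/existsP[j /andP[jk /eqP Lj]] := dk0; exists j.
have finj : injective f.
  by move=> c c' e; have := (Hf c).2; rewrite e (Hf c').2 => -[].
have fsurj j : j != k0 -> exists c, j = f c.
  move=> jk.
  have : f @: [set: 'I_m]%SET = [set~ k0]%SET.
    apply/eqP; rewrite eqEcard cardsC1 card_imset // cardsT !card_ord leqnn andbT.
    by apply/fintype.subsetP => _ /imsetP[c _ ->]; rewrite !inE; case: (Hf c).
  by move/setP/(_ j); rewrite !inE jk => /imsetP[c _ ->]; exists c.
case Lk0 : (L k0) => [c0 []]; last by case: (antip _ _ _ (Hf c0).2 Lk0).
have k01 : f c0 != k0 := (Hf c0).1.
have dE (k : 'I_m.+1) : door v s k = (k \in [set k0; f c0]).
  rewrite !inE; apply/forallP/orP => [dk|[/eqP ->|/eqP ->] c].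
  - case: (eqVneq k k0) => [|kk0]; [by left|right].
    have [c kE] := fsurj _ kk0.
    have /existsP[j /andP[jk /eqP Lj]] := dk c; rewrite -/(L j) in Lj.
    case: (eqVneq j k0) => jk0.
      by move: Lj; rewrite jk0 Lk0 => -[->]; rewrite kE.
    have [c' jE] := fsurj _ jk0.
    move: Lj; rewrite jE (Hf c').2 => -[cc].
    by move: jk; rewrite jE cc kE eqxx.
  - by apply/existsP; exists (f c); rewrite -/(L _) (Hf c).2 eqxx andbT; case: (Hf c).
  - apply/existsP; case: (eqVneq c c0) => [->|cc].
      by exists k0; rewrite -/(L _) Lk0 eqxx andbT eq_sym.
    exists (f c); rewrite -/(L _) (Hf c).2 eqxx andbT.
    by rewrite (inj_eq val_inj) (inj_eq finj).
rewrite (eq_bigr (fun k : 'I_m.+1 => (k \in [set k0; f c0]) : nat)); last by move=> k _; rewrite dE.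
by rewrite -big_mkcond sum1_card cards2 eq_sym k01.
Qed.

(** The path taking the steps [k - 1] and [k] in the other order differs only in its vertex [k], so
    the two simplices share this facet. *)
Lemma inner_doors_even v (k : nat) : 0 < k < m ->
  odd (\sum_(s : 'S_m) door v s k) = false.
Proof.
move=> /andP[k0 km].
have km' : k.-1 < m by lia.
apply: (@odd_sum_swap _ _ (Ordinal km') (Ordinal km)).
  by apply/eqP => -[]; lia.
move=> s; congr (nat_of_bool _); apply: eq_forallb => c; apply: eq_existsb => j.
case: (eqVneq (j : nat) k) => //= jk; congr (lab _ == _).
apply/ffunP => i; rewrite !ffunE permM; congr (_ + nat_of_bool _).
by case: tpermP => [->|->|_ _] /=; lia.
Qed.

Hypothesis lab_low : forall (x : pt) i, x i = 0 -> (forall j : 'I_m, j < i -> x j != 0) ->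
  lab x = (i, true).
Hypothesis lab_high : forall (x : pt) i, x i = M -> lab x != (i, true).

Definition shift_time (s : 'S_m) : 'S_m := (s * perm (@ord_pred_inj m))%g.

Notation box := {ffun 'I_m -> 'I_M.+1}.
Definition coords (v : box) (i : 'I_m) : nat := v i.
Definition last_moved (s : 'S_m) : 'I_m := (s^-1)%g ord_max.

Lemma val_ord_pred (i : 'I_m) : ord_pred i = (if i == 0 :> nat then n else i.-1) :> nat.
Proof.
case: i => -[|k] km; rewrite /ord_pred [LHS]/=; first by rewrite modn_small.
by rewrite modnDr modn_small // ltnW.
Qed.

(** Dropping the first step of a path and repeating its direction at the end gives the adjacent
    simplex across this facet: the base has moved one step in that direction, which is now moved
    last. *)
Lemma door_shift (v : 'I_m -> nat) (s : 'S_m) :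
  door v s 0 =
  door (fun i => v i + (i == last_moved (shift_time s))) (shift_time s) m.
Proof.
pose s' := shift_time s; pose i0 := last_moved s'.
have s'E i : s' i = ord_pred (s i) by rewrite permM permE.
have i0E : s i0 = 0 :> nat.
  have : s' i0 = ord_max by rewrite permKV.
  rewrite s'E => /(congr1 (@nat_of_ord _)); rewrite val_ord_pred /=.
  by have := ltn_ord (s i0); case: eqP => //; lia.
have i0P i : i != i0 -> (s' i).+1 = s i.
  move=> ii0; rewrite s'E val_ord_pred.
  have : s i != 0 :> nat.
    by rewrite -i0E (inj_eq val_inj) (inj_eq perm_inj).
  by case: eqP => //; lia.
have s'i0 : s' i0 = n :> nat by rewrite permKV.
have key (j : nat) : j < m ->
    kuhn_vertex v s j.+1 = kuhn_vertex (fun i => v i + (i == i0)) s' j.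
  move=> jm; apply/ffunP => i; rewrite !ffunE.
  case: (eqVneq i i0) => [->|/i0P <-]; last by rewrite addn0.
  by rewrite i0E s'i0; lia.
apply: eq_forallb => c; apply/existsP/existsP => -[j /andP[jk Lj]].
  have j0 : j.-1 < m.+1 by have := ltn_ord j; lia.
  exists (Ordinal j0) => /=; have := ltn_ord j => jm.
  by rewrite -key; [rewrite prednK ?lt0n // Lj andbT; lia|lia].
have jm : j < m by have := ltn_ord j; lia.
have j1 : j.+1 < m.+1 by [].
by exists (Ordinal j1) => /=; rewrite key.
Qed.

(** The facet lies in the face [x i = M] with [i = last_moved s], where [lab_high] excludes the
    label [(i, true)]. *)
Lemma last_face_high (w : box) s : w (last_moved s) = M :> nat ->
  door (coords w) s m = false.
Proof.
move=> wM; apply/negbTE/forallPn; exists (last_moved s).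
apply/existsPn => j; rewrite negb_and negbK orbC -implyNb; apply/implyP; rewrite negbK => /eqP Lj.
apply/negPn; rewrite negbK; apply/eqP.
have := @lab_high (kuhn_vertex (coords w) s j) (last_moved s).
rewrite Lj eqxx ffunE /coords wM permKV /= => H.
by have := ltn_ord j; case: (ltnP n j) => [|nj]; [lia|];  have : true != true by apply: H; lia.
Qed.


Lemma lab_first_zero (x : pt) i c b : x i = 0 -> lab x = (c, b) ->
  x c = 0 /\ forall j : 'I_m, j < c -> x j != 0.
Proof.
move=> xi0; have [i0 xi0' mini0] := @arg_minnP _ i (fun i => x i == 0) (@nat_of_ord m) (introT eqP xi0).
have xj (j : 'I_m) : j < i0 -> x j != 0 by apply: contraL => /mini0; rewrite -leqNgt.
by rewrite (lab_low (eqP xi0') xj) => -[<- _]; split => //; apply/eqP.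
Qed.

(** On this face the label of a vertex is its first vanishing coordinate. A door thus has, for each
    [c], a vertex [f c] where the coordinates below [c] are already raised and [c] is not. Then [f]
    is strictly increasing, hence the identity, and the path starts at the origin and moves the
    coordinates in their natural order. *)
Lemma first_face (w : box) s : w (last_moved s) = 0 :> nat ->
  door (coords w) s m = (w == [ffun=> ord0]) && (s == 1%g).
Proof.
set l := last_moved s => w0; apply/forallP/andP; last first.
  case=> /eqP-> /eqP-> c.
  have cm : c < m.+1 by apply: ltnW; rewrite ltnS.
  apply/existsP; exists (Ordinal cm) => /=; rewrite ltn_eqF //=; apply/eqP.
  apply: lab_low => [|j jc]; first by rewrite ffunE /coords ffunE perm1 ltnn.
  by rewrite ffunE perm1 jc addn1.
move=> dw.
have sl : s l = n :> nat by rewrite permKV.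
have /fin_all_exists[f Hf] : forall c, exists j : 'I_m,
    kuhn_vertex (coords w) s j c = 0 /\ forall i : 'I_m, i < c -> kuhn_vertex (coords w) s j i != 0.
  move=> c; have /existsP[j /andP[jm /eqP Lj]] := dw c.
  have jm' : j < m by have := ltn_ord j; lia.
  exists (Ordinal jm'); apply: (lab_first_zero (i := l)) Lj.
  by rewrite ffunE /coords w0 sl; lia.
have fmono (c c' : 'I_m) : c < c' -> f c < f c'.
  move=> cc; have := (Hf c).1; have := (Hf c').2 _ cc; rewrite !ffunE; lia.
have fge k : forall c : 'I_m, c = k :> nat -> k <= f c.
  elim: k => // k IH c ck.
  have kn : k < m by have := ltn_ord c; lia.
  have := IH (Ordinal kn) erefl; have := @fmono (Ordinal kn) c; rewrite ck /= => /(_ (leqnn _)); lia.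
have fle k : forall c : 'I_m, c + k = n -> f c + k <= n.
  elim: k => [|k IH] c ck; first by have := ltn_ord (f c); lia.
  have kn : c.+1 < m by lia.
  have := IH (Ordinal kn); have := @fmono c (Ordinal kn); rewrite /= => /(_ (leqnn _)); lia.
have fE c : f c = c :> nat.
  have := fge c c erefl; have := @fle (n - c) c; have := ltn_ord c; lia.
have wE c : w c = 0 :> nat.
  by have := (Hf c).1; rewrite ffunE /coords; lia.
split; first by apply/eqP/ffunP => c; rewrite ffunE; apply: val_inj; rewrite /= wE.
apply/eqP/permP => c; rewrite perm1; apply: val_inj => /=.
have h1 := (Hf c).1; rewrite ffunE /coords fE wE in h1.
case: (eqVneq (c : nat) n) => cn; first by have := ltn_ord (s c); lia.
have kn : c.+1 < m by have := ltn_ord c; lia.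
have := (Hf (Ordinal kn)).2 c (leqnn _); rewrite ffunE /coords fE wE /=; lia.
Qed.

(* Every simplex has an even number of doors, and a door is shared by two
   simplices unless it lies on the boundary, where there is exactly one. *)
Lemma door_contradiction : 0 < M -> False.
Proof.
move=> M0.
pose inbox (v : box) := [forall i, v i < M].
pose core (w : box) s := [forall i, (i != last_moved s) ==> (w i < M)].
pose S0 := \sum_s \sum_(v | inbox v) door (coords v) s 0.
pose Sm := \sum_s \sum_(v | inbox v) door (coords v) s m.
have even0m : odd (S0 + Sm) = false.
  have : odd (\sum_(v | inbox v) \sum_s \sum_(k < m.+1) door (coords v) s k) = false.
    rewrite (big_morph odd oddD (erefl : odd 0 = false)) big1 // => v _.
    by rewrite (big_morph odd oddD (erefl : odd 0 = false)) big1 // => s _; exact: doors_even.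
  rewrite exchange_big /=.
  have -> : \sum_s \sum_(v | inbox v) \sum_(k < m.+1) door (coords v) s k =
     \sum_(k < m.+1) \sum_s \sum_(v | inbox v) door (coords v) s k.
    by rewrite [RHS]exchange_big /=; apply: eq_bigr => s _; rewrite exchange_big.
  rewrite big_ord_recl big_ord_recr /= addnCA oddD [X in X (+) _](_ : _ = false) //.
  rewrite (big_morph odd oddD (erefl : odd 0 = false)) big1 // => k _.
  rewrite exchange_big /= (big_morph odd oddD (erefl : odd 0 = false)) big1 // => v _.
  by apply: inner_doors_even; rewrite /bump /=; have := ltn_ord k; lia.
(* By [door_shift] the doors at the vertex [0] become doors at the last vertex; the base gains one
   in the coordinate [l], whose range is now 1 to [M] instead of 0 to [M - 1]. *)
have S0E : S0 = \sum_s \sum_(w | core w s && (0 < w (last_moved s))) door (coords w) s m.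
  rewrite [RHS](reindex_inj (mulIg (perm (@ord_pred_inj m)))) /=.
  apply: eq_bigr => s _; rewrite -/(shift_time s).
  set s' := shift_time s; set l := last_moved s'.
  rewrite [RHS](reindex_onto (fun v : box => [ffun i => inord (v i + (i == l)) : 'I_M.+1])
                        (fun w : box => [ffun i => inord (w i - (i == l)) : 'I_M.+1])) /=; last first.
    move=> w /andP[cw w0]; apply/ffunP => i; rewrite !ffunE; apply: val_inj => /=.
    have := ltn_ord (w i); case: (eqVneq i l) => [->|il] wi; first by rewrite !inordK; lia.
    by rewrite !inordK; lia.
  apply: eq_big => [v|v /forallP vM].
    apply/forallP/andP => [vM|[]].
      split; last first.
        apply/eqP/ffunP => i; rewrite !ffunE; apply: val_inj => /=.
        by have := vM i; case: (i == l) => vi; rewrite !inordK; lia.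
      have vl := vM l; apply/andP; split; last by rewrite ffunE eqxx inordK addn1.
      apply/forallP => i; apply/implyP => il; rewrite ffunE (negbTE il) addn0 inordK; [exact: vM|exact: ltn_ord].
    move=> /andP[/forallP cw lw] /eqP/ffunP vE i.
    case: (eqVneq i l) => il; last first.
      have := cw i; rewrite il ffunE (negbTE il) addn0 /= inordK //; exact: ltn_ord.
    move: lw (vE l); rewrite !ffunE eqxx -il => lw.
    move: (ltn_ord (v i)); rewrite ltnS leq_eqVlt => /orP[/eqP vi|//].
    by move: lw; rewrite vi addn1 /inord /insubd insubF //= ltnn.
  rewrite door_shift -/s' -/l; congr (nat_of_bool _).
  apply: eq_forallb => c; apply: eq_existsb => j; congr (_ && (lab _ == _)).
  apply/ffunP => i; rewrite !ffunE /coords ffunE inordK //.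
  by have := vM i; case: (i == l); lia.
have SmE : Sm = \sum_s \sum_(w | core w s) door (coords w) s m.
  apply: eq_bigr => s _; rewrite [RHS](bigID inbox) /= [X in _ + X]big1 ?addn0.
    apply: eq_bigl => w; apply/idP/andP => [/forallP wM|[]//]; split; last exact/forallP.
    by apply/forallP => i; apply/implyP => _; exact: wM.
  move=> w /andP[/forallP cw /forallPn[i]]; rewrite -leqNgt => wi.
  rewrite last_face_high //; have := cw (last_moved s).
  case: (eqVneq i (last_moved s)) => [<- _|il].
    by have := ltn_ord (w i); lia.
  by have := cw i; rewrite il /=; lia.
have SmS0 : Sm = S0 + \sum_s \sum_(w | core w s && (w (last_moved s) == 0 :> nat)) door (coords w) s m.
  rewrite SmE S0E -big_split /=; apply: eq_bigr => s _.
  rewrite (bigID (fun w : box => 0 < w (last_moved s))) /=; congr (_ + _).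
  by apply: eq_bigl => w; rewrite lt0n negbK.
(* All else cancels in pairs; on the lower faces only the corner with the identity order has a
   door. *)
have one : \sum_s \sum_(w | core w s && (w (last_moved s) == 0 :> nat)) door (coords w) s m = 1.
  rewrite (bigD1 (1%g : 'S_m)) //= [X in _ + X]big1 ?addn0; last first.
    by move=> s s1; rewrite big1 // => w /andP[_ /eqP w0]; rewrite first_face // (negbTE s1) andbF.
  have z0 : ([ffun=> ord0] : box) (last_moved (1%g : 'S_m)) = 0 :> nat by rewrite ffunE.
  rewrite (bigD1 [ffun=> ord0]) /=.
    rewrite first_face ?z0 // !eqxx big1 // => w /andP[/andP[_ /eqP w0] wn0].
    by rewrite first_face // (negbTE wn0).
  rewrite z0 andbT; apply/forallP => i; apply/implyP => _; by rewrite ffunE.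
by move: even0m; rewrite SmS0 one addnA addnn addn1 /= odd_double.
Qed.

End Kuhn.

(** * Lower bounds for the asymptotic dimension *)

Local Open Scope classical_set_scope.
Local Open Scope ring_scope.

Section GridAsdim.
Variables (R : realType) (T : Type) (d : T -> T -> \bar R) (n : nat).
Local Notation m := n.+1.
Variable f : {ffun 'I_m -> nat} -> T.
Variable r : R.
Hypothesis f_lip : forall x y, neighbours x y -> (d (f x) (f y) <= r%:E)%E.
Hypothesis f_proper : forall D : R, exists N : nat, forall x y (i : 'I_m),
  (d (f x) (f y) <= D%:E)%E -> (x i < y i + N)%N.

(* The label of a grid point is the family of a chosen member of the cover
   containing it, with a sign telling whether that member reaches the lower face
   in the direction of the family.  The grid is surrounded by a layer with
   prescribed labels. *)
Lemma asdim_le_grid k : asdim_le d k -> (n < k)%N.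
Proof.
move=> dk; rewrite ltnNge; apply/negP => kn.
pose r' := Num.max r 1.
have r'0 : 0 < r' by rewrite lt_max ltr01 orbT.
have [U [D [Ucov Ubd Usep]]] := dk r' r'0.
have [N HN] := f_proper D.
(* A member of the cover meeting the layer [x i = 1] stays below [x i = N + 1], whereas an inner
   point next to the upper face has [x i = N + 1]. *)
pose M := N.+2.
have km : (k.+1 <= m)%N by [].
have /choice[cA HcA] : forall x, exists cA : 'I_k.+1 * set T, U cA.1 cA.2 /\ cA.2 x.
  by move=> x; have [i [A [UA Ax]]] := Ucov x; exists (i, A).
pose inner (y : {ffun 'I_m -> nat}) := [forall i, (0 < y i < M)%N].
pose col (x : {ffun 'I_m -> nat}) : 'I_m := widen_ord km (cA (f x)).1.
pose reach (x : {ffun 'I_m -> nat}) : bool :=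
  `[< exists y, [/\ inner y, y (col x) = 1%N & (cA (f x)).2 (f y)] >].
pose lab (x : {ffun 'I_m -> nat}) : 'I_m * bool :=
  if [pick i | x i == 0%N] is Some i then ([arg min_(j < i | x j == 0%N) (j : nat)], true)
  else if [pick i | (M <= x i)%N] is Some i then (i, false)
  else (col x, reach x).
have labP (x : {ffun 'I_m -> nat}) :
    [\/ exists i, [/\ x i = 0%N, forall j : 'I_m, (j < i)%N -> x j != 0%N & lab x = (i, true)],
        [/\ forall i, x i != 0%N & exists i, (M <= x i)%N /\ lab x = (i, false)] |
        inner x /\ lab x = (col x, reach x)].
  rewrite /lab; case: pickP => [i xi0|x0].
    case: arg_minnP => // j xj0 jmin; constructor 1; exists j; split => //; first exact/eqP.
    by move=> j' jj; apply: contraL jj => /jmin; rewrite -leqNgt.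
  case: pickP => [i xiM|xM].
    by constructor 2; split; [move=> j; rewrite x0|exists i].
  constructor 3; split => //; apply/forallP => i.
  by rewrite lt0n x0 /= ltnNge xM.
(* Neighbours are mapped to points at distance at most [r], and distinct members of one family are
   further apart, so both points lie in the same member. *)
have same x y : neighbours x y -> inner x -> inner y -> col x = col y -> reach x = reach y.
  move=> xy _ _ cxy.
  have [Ux xA] := HcA (f x); have [Uy yA] := HcA (f y).
  have cE : (cA (f x)).1 = (cA (f y)).1.
    by apply: val_inj; have := congr1 val cxy.
  have AE : (cA (f x)).2 = (cA (f y)).2.
    apply: contrapT => nAE; rewrite -cE in Uy.
    have := Usep _ _ _ _ _ Ux Uy nAE xA yA; rewrite ltNge.
    by rewrite (le_trans (f_lip xy)) // lee_fin le_max lexx.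
  by rewrite /reach cxy AE.
have opp x y i : lab x = (i, true) -> lab y = (i, false) -> (x i <= y i <= (x i).+1)%N \/ (y i <= x i <= (y i).+1)%N ->
    (inner x -> inner y -> col x = col y -> reach x = reach y) -> False.
  move=> lx ly xyi sxy.
  case: (labP y) => [[j [_ _]]|[y0 [j [yM]]]|[iny]]; rewrite ly // => -[].
    move=> ij; rewrite -ij in yM.
    case: (labP x) => [[j' [xj _]]|[_ [j' [_]]]|[inx]]; rewrite lx // => -[].
      by move=> ij'; rewrite -ij' in xj; rewrite xj /M in xyi yM; lia.
    move=> iE /esym/asboolP[z [inz zi Az]].
    have [Ux xA] := HcA (f x).
    have := HN x z i (Ubd _ _ _ _ Ux xA Az).
    by rewrite iE zi -iE; move: xyi yM; rewrite /M; lia.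
  move=> iE /esym/asboolPn nry.
  case: (labP x) => [[j' [xj _]]|[_ [j' [_]]]|[inx]]; rewrite lx // => -[].
    move=> ij'; rewrite -ij' in xj.
    (* An inner neighbour of the lower face has coordinate 1, so [y] itself witnesses that its
       member reaches that layer. *)
    apply: nry; exists y; split=> //; last exact: (HcA _).2.
    have /forallP/(_ i) := iny; rewrite -iE; move: xyi; rewrite xj; lia.
  move=> iE' rx; have := sxy inx iny; rewrite -iE -iE' => /(_ erefl).
  by rewrite -rx => /esym/asboolP/nry.
apply: (@door_contradiction n M lab) => //.
- move=> x y b c xy lx ly; case: b lx ly => lx ly.
    by apply: (opp x y c lx ly); [left; exact: xy|exact: same].
  apply: (opp y x c ly lx); [right; exact: xy|].
  by move=> iny inx /esym cxy; apply/esym/same.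
- move=> x i xi0 xj; case: (labP x) => [[j [xj0 xlt ->]]|[/(_ i)]|[/forallP/(_ i)]].
  + congr (_, _); apply: val_inj => /=; case: (ltngtP i j) => // ij.
      by have := xlt _ ij; rewrite xi0.
    by have := xj _ ij; rewrite xj0.
  + by rewrite xi0.
  + by rewrite xi0.
- move=> x i xiM; apply/eqP => lx; case: (labP x) => [[j [xj0 _]]|[_ [j [_]]]|[/forallP/(_ i)]].
  + by rewrite lx => -[ij]; move: xj0; rewrite -ij xiM.
  + by rewrite lx.
  + by rewrite xiM ltnn andbF.
Qed.

End GridAsdim.

Definition reach (G : groupType) (S : set G) (k : nat) (g : G) : Prop :=
  exists2 w, words S g w & (size w <= k)%N.

Section WordLength.
Variables (R : realType) (G : groupType) (S : set G).
Implicit Types (g h : G) (k : nat).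

Lemma reach1 k : reach S k 1%g.
Proof. by exists [::] => //; split => [s|]; rewrite ?big_nil. Qed.

Lemma reach_gen g : S g -> reach S 1 g.
Proof.
move=> Sg; exists [:: g] => //; split=> [s|]; last by rewrite big_seq1.
by rewrite inE => /eqP->.
Qed.

Lemma reachM k l g h : reach S k g -> reach S l h -> reach S (k + l) (g * h)%g.
Proof.
move=> [v [vS <-] vk] [w [wS <-] wl]; exists (v ++ w); last by rewrite size_cat leq_add.
by split=> [s|]; rewrite ?big_cat // mem_cat => /orP[/vS|/wS].
Qed.

Lemma reach_le k l g : (k <= l)%N -> reach S k g -> reach S l g.
Proof. by move=> kl [w wg wk]; exists w => //; exact: leq_trans kl. Qed.

Lemma reachV k g : (forall s, S s -> S s^-1%g) -> reach S k g -> reach S k g^-1%g.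
Proof.
move=> SV [w [wS <-] wk]; exists (rev [seq s^-1%g | s <- w]); last by rewrite size_rev size_map.
split=> [s|].
  by rewrite mem_rev => /mapP[t /wS St ->]; exact: SV.
by rewrite -map_rev big_map prodgV revK.
Qed.

Lemma reach_word_length k g : reach S k g -> (word_length R S g <= k%:R%:E)%E.
Proof.
move=> [w wg wk]; apply: le_trans (_ : (size w)%:R%:E <= _)%E; last by rewrite lee_fin ler_nat.
by apply: ereal_inf_lbound; exists w.
Qed.

Lemma word_length_reach k g : (word_length R S g < k.+1%:R%:E)%E -> reach S k g.
Proof.
by move=> /ereal_inf_lt[_ [w wg <-]]; rewrite lte_fin ltr_nat => wk; exists w.
Qed.

Lemma word_length_reach_bound (D : R) :
  exists k, forall g, (word_length R S g <= D%:E)%E -> reach S k g.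
Proof.
exists (Num.bound `|D|) => g gD; apply: word_length_reach; apply: le_lt_trans gD _.
rewrite lte_fin; apply: le_lt_trans (real_ler_norm _) _; first exact: num_real.
by apply: lt_le_trans (archi_boundP (normr_ge0 D)) _; rewrite ler_nat.
Qed.

Lemma ball_finite k : finite_set S -> exists L : seq G, forall g, reach S k g -> g \in L.
Proof.
move=> /finite_seqP[E SE]; elim: k => [|k [L HL]].
  exists [:: 1%g] => g [[|//] [_ <-] _]; by rewrite big_nil inE.
exists (1%g :: [seq (s * h)%g | s <- E, h <- L]) => g [[|s w] [wS <-] wk].
  by rewrite big_nil inE eqxx.
rewrite big_cons inE; apply/orP; right; apply/allpairsP.
exists (s, \prod_(x <- w) x)%g; split => //=.
  by have := wS s (mem_head _ _); rewrite SE.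
by apply: HL; exists w => //; split=> // t tw; apply: wS; rewrite inE tw orbT.
Qed.

End WordLength.

Section CommutingElements.
Variables (R : realType) (G : groupType) (S : set G) (n : nat) (t : 'I_n.+1 -> G).
Hypothesis genS : finite_symmetric_generating S.
Hypothesis tC : forall i j, commute (t i) (t j).

Definition monomial (x : {ffun 'I_n.+1 -> nat}) : G := (\prod_i t i ^+ x i)%g.

Hypothesis monomial_inj : injective monomial.

Lemma monomialD (x y : {ffun 'I_n.+1 -> nat}) : monomial [ffun i => (x i + y i)%N] = (monomial x * monomial y)%g.
Proof.
rewrite /monomial -prodgM_commute => [|i j _ _]; last exact/commuteX2.
by apply: eq_bigr => i _; rewrite ffunE expgnDr.
Qed.

Lemma monomialC (x y : {ffun 'I_n.+1 -> nat}) : commute (monomial x) (monomial y).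
Proof.
rewrite /commute -!monomialD; congr monomial.
by apply/ffunP => i; rewrite !ffunE addnC.
Qed.

Lemma monomial_neighbours_reach : exists k, forall x y : {ffun 'I_n.+1 -> nat},
  neighbours x y -> reach S k ((monomial x)^-1 * monomial y)%g.
Proof.
have [_ _ gen] := genS.
have /fin_all_exists[l Hl] : forall i, exists l, reach S l (t i).
  by move=> i; have [w wt] := gen (t i); exists (size w), w.
exists (\sum_i l i)%N => x y xy.
have -> : y = [ffun i => (x i + [ffun i => (y i - x i)%N] i)%N].
  by apply/ffunP => i; rewrite !ffunE subnKC //; have /andP[] := xy i.
rewrite monomialD mulKg /monomial.
elim/big_rec2: _ => [|i g k _ IH]; first exact: reach1.
apply: reachM => //; rewrite ffunE.
have [->|->] : (y i - x i = 0)%N \/ (y i - x i = 1)%N by have := xy i; lia.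
  exact: reach1.
exact: Hl.
Qed.

(** By [monomial_inj], all pairs [(x, y)] with a given quotient have the same difference [y - x], so
    one such pair [(x0, y0)] yields the constant for its element of [L]. *)
Lemma monomial_proper (L : seq G) : exists N : nat, forall x y i,
  ((monomial x)^-1 * monomial y)%g \in L -> (x i < y i + N)%N.
Proof.
elim: L => [|g L [N HN]]; first by exists 0%N.
have [[x0 [y0 g0]]|nog] := pselect (exists x y, (monomial x)^-1 * monomial y = g)%g; last first.
  exists N => x y i; rewrite inE => /orP[/eqP xyg|]; last exact: HN.
  by case: nog; exists x, y.
exists (N + (\sum_i x0 i).+1)%N => x y i; rewrite inE => /orP[/eqP|/(HN _ _ i)]; last by lia.
rewrite -g0 => xyE.
have : [ffun i => (y i + x0 i)%N] = [ffun i => (x i + y0 i)%N].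
  apply: monomial_inj; rewrite !monomialD (monomialC y).
  have -> : monomial y = (monomial x * ((monomial x0)^-1 * monomial y0))%g by rewrite -xyE mulVKg.
  by rewrite mulgA (monomialC x0) -mulgA mulVKg.
move=> /ffunP/(_ i); rewrite !ffunE => e.
have : (x0 i <= \sum_i x0 i)%N by rewrite (bigD1 i) //= leq_addr.
by lia.
Qed.

(** The monomials embed the positive orthant of [Z^(n + 1)]. Neighbours stay at bounded distance,
    and the finiteness of balls makes the embedding proper, as the grid lemma demands. *)
Lemma asdim_le_commuting k : asdim_le (word_dist R S) k -> (n < k)%N.
Proof.
have [l Hl] := monomial_neighbours_reach.
apply: (@asdim_le_grid _ _ _ _ monomial l%:R) => [x y xy|D].
  exact/reach_word_length/Hl.
have [k' Hk] := word_length_reach_bound S D.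
have [L HL] := ball_finite k' (let: And3 f _ _ := genS in f).
by have [N HN] := monomial_proper L; exists N => x y i xyD; apply/HN/HL/Hk.
Qed.

End CommutingElements.

(** * Groups of bijections *)

(** The inverse is stored as data, so that the inverse of a group element can be evaluated at a
    point. *)
Record sym (T : Type) := Bijection {
  sym_fun :> T -> T;
  sym_inv : T -> T;
  sym_funK : cancel sym_fun sym_inv;
  sym_invK : cancel sym_inv sym_fun }.

Section SymGroup.
Variable T : Type.
Implicit Types f g h : sym T.

Lemma symP f g : (forall x, f x = g x) -> f = g.
Proof.
case: f g => [f f' fK f'K] [g g' gK g'K] /= fg.
have fgE : f = g by apply/funext.
move: fK f'K; rewrite fgE => fK f'K.
have fgE' : f' = g' by apply/funext => x; rewrite -{1}[x]g'K fK.
by move: fK f'K; rewrite fgE' => fK f'K; congr Bijection; exact: Prop_irrelevance.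
Qed.

HB.instance Definition _ := gen_eqMixin (sym T).
HB.instance Definition _ := gen_choiceMixin (sym T).

Definition sym1 : sym T := @Bijection T id id (fun=> erefl) (fun=> erefl).
Definition symV f : sym T := Bijection (@sym_invK _ f) (@sym_funK _ f).
Definition symM f g : sym T :=
  Bijection (can_comp (@sym_funK _ f) (@sym_funK _ g)) (can_comp (@sym_invK _ g) (@sym_invK _ f)).

Fact symMA : associative symM. Proof. by move=> f g h; apply: symP. Qed.
Fact sym1M : left_id sym1 symM. Proof. by move=> f; apply: symP. Qed.
Fact symM1 : right_id sym1 symM. Proof. by move=> f; apply: symP. Qed.
Fact symVM : left_inverse sym1 symV symM.
Proof. by move=> f; apply: symP => x /=; rewrite sym_funK. Qed.
Fact symMV : right_inverse sym1 symV symM.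
Proof. by move=> f; apply: symP => x /=; rewrite sym_invK. Qed.

HB.instance Definition _ := isGroup.Build (sym T) symMA sym1M symM1 symVM symMV.

Lemma symME f g x : (f * g)%g x = f (g x). Proof. by []. Qed.
Lemma sym1E x : (1%g : sym T) x = x. Proof. by []. Qed.

End SymGroup.

Section GeneratedSubgroup.
Variables (G : groupType) (gens : seq G).

Definition sym_gens : set G := [set g | g \in gens \/ g^-1%g \in gens].

Lemma sym_gensV s : sym_gens s -> sym_gens s^-1%g.
Proof. by case=> sg; [right; rewrite invgK|left]. Qed.

Definition gen_pred : pred G := fun g => `[< exists k, reach sym_gens k g >].

Fact gen_group_closed : group_closed gen_pred.
Proof.
split; first by apply/asboolP; exists 0%N; exact: reach1.
move=> g h /asboolP[k gk] /asboolP[l hl]; apply/asboolP; exists (k + l)%N.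
by apply: reachM => //; apply: reachV => //; exact: sym_gensV.
Qed.

Definition gsub := {g : G | gen_pred g}.
HB.instance Definition _ := SubChoice.on gsub.
HB.instance Definition _ := SubChoice_isSubGroup.Build G gen_pred gsub gen_group_closed.

Definition gsub_gens : set gsub := [set h | sym_gens (val h)].

Lemma val_prod (w : seq gsub) : val (\prod_(h <- w) h)%g = (\prod_(g <- map val w) g)%g.
Proof. by elim: w => [|h w IH]; rewrite ?big_nil // !big_cons -IH. Qed.

Lemma reach_val k (h : gsub) : reach gsub_gens k h -> reach sym_gens k (val h).
Proof.
move=> [w [wS <-] wk]; exists (map val w); last by rewrite size_map.
by split=> [s /mapP[t /wS St ->]|]; rewrite ?val_prod.
Qed.

Lemma val_reach k (h : gsub) : reach sym_gens k (val h) -> reach gsub_gens k h.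
Proof.
move=> [w [wS wh] wk].
have [v [vw vS]] : exists v : seq gsub, map val v = w /\ forall s, s \in v -> gsub_gens s.
  elim: w wS {wh wk} => [|s w IH] wS; first by exists [::].
  have [v [<- vS]] := IH (fun t tw => wS t (mem_behead (s := s :: w) tw)).
  have Ss := wS s (mem_head _ _).
  have gs : gen_pred s by apply/asboolP; exists 1%N; exact: reach_gen.
  exists ((exist _ s gs : gsub) :: v); split=> // t; rewrite inE => /orP[/eqP->|/vS] //.
exists v; last by rewrite -(size_map val) vw.
by split=> //; apply: val_inj; rewrite val_prod vw.
Qed.

Lemma gsub_reach k g : reach sym_gens k g -> exists2 h : gsub, val h = g & reach gsub_gens k h.
Proof.
move=> gk; have gg : gen_pred g by apply/asboolP; exists k.
by exists (exist _ g gg : gsub) => //; exact: val_reach.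
Qed.

Lemma reach_gsub (h : gsub) : exists k, reach sym_gens k (val h).
Proof. by have /asboolP := valP h. Qed.

Lemma gsub_generating : finite_symmetric_generating gsub_gens.
Proof.
split; last first.
- by move=> g; have [k /val_reach[w wg _]] := reach_gsub g; exists w.
- by move=> s; exact: sym_gensV.
apply/finite_seqP; exists (pmap insub (gens ++ [seq g^-1%g | g <- gens])).
apply/seteqP; split=> h /=; rewrite mem_pmap.
  case=> hg; apply/mapP; exists (val h); rewrite ?valK // mem_cat ?hg //.
  by apply/orP; right; apply/mapP; exists (val h)^-1%g; rewrite ?invgK.
case/mapP => g; rewrite mem_cat => gg; case: insubP => // u _ ug [hu].
move: gg; rewrite -ug -hu => /orP[|/mapP[s sg hs]]; [by left|right].
by rewrite hs invgK.
Qed.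

End GeneratedSubgroup.
Arguments gsub_gens {G} gens _.

(** * Binary configurations on the square lattice *)

Notation site := (int * int)%type.
Definition config : Type := site -> bool.

Implicit Types (x y : config) (p u z : site).

Definition up (z : site) (n : nat) : site := (z.1, z.2 + n%:Z).

Lemma upS z n : up z n.+1 = up (up z 1) n.
Proof. by rewrite /up /= -addrA. Qed.

Lemma up0 z : up z 0 = z.
Proof. by case: z => a b; rewrite /up /= addr0. Qed.

Definition flip_fun z x : config := fun u => x u (+) (u == z).
Definition transl_fun p x : config := fun u => x (u - p).

(* The carry started at [z] reaches the site [up z n] when adding ([c = true]) or
   subtracting ([c = false]) one. *)
Definition carry (c : bool) z (n : nat) x : bool := all (fun m => x (up z m) == c) (iota 0 n).

(** A ray is infinite, so a carry along it may run forever; since only the sites below [u] decide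
    whether [u] is reached, the odometer is still defined on every configuration. *)
Definition on_ray z u : bool := (u.1 == z.1) && (z.2 <= u.2).

Definition odo_fun c z x : config := fun u =>
  x u (+) (on_ray z u && carry c z `|u.2 - z.2|%N x).

Lemma carryP c z n x : reflect (forall m, (m < n)%N -> x (up z m) = c) (carry c z n x).
Proof.
apply: (iffP allP) => [H m mn|H m]; first by apply/eqP/H; rewrite mem_iota.
by rewrite mem_iota => /H ->.
Qed.

Lemma carryS c z n x : carry c z n.+1 x = (x z == c) && carry c (up z 1) n x.
Proof.
apply/carryP/andP => [H|[/eqP x0 /carryP H] [|m] mn]; last by rewrite upS H.
  split; first by rewrite -(H 0%N) ?up0.
  by apply/carryP => m mn; rewrite -upS H.
by rewrite up0.
Qed.

Lemma on_rayP z u : reflect (exists n, u = up z n) (on_ray z u).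
Proof.
apply: (iffP andP) => [[/eqP e zu]|[n ->]]; last by split=> //=; lia.
exists `|u.2 - z.2|%N; case: u e zu => a b /= -> zu; congr (_, _); lia.
Qed.

Lemma odo_up c z n x : odo_fun c z x (up z n) = x (up z n) (+) carry c z n x.
Proof.
rewrite /odo_fun (introT (on_rayP _ _)); last by exists n.
by congr (_ (+) carry _ _ _ _); rewrite /up /=; lia.
Qed.

Lemma odo_off c z u x : ~~ on_ray z u -> odo_fun c z x u = x u.
Proof. by rewrite /odo_fun => /negbTE->; rewrite addbF. Qed.

(** Adding one turns the initial run of ones into a run of zeros of the same length, so a subsequent
    subtraction flips back exactly the same sites. *)
Lemma carry_odo c z n x : carry (~~ c) z n (odo_fun c z x) = carry c z n x.
Proof.
apply/carryP/carryP => H m mn; last first.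
  rewrite odo_up (introT (carryP _ _ _ _)) ?H ?addbT // => k km.
  by apply: H; exact: ltn_trans mn.
elim/ltn_ind: m mn => m IH mn.
have := H m mn; rewrite odo_up (introT (carryP _ _ _ _)) ?addbT.
  by move/negb_inj.
by move=> k km; apply: IH => //; exact: ltn_trans mn.
Qed.

Lemma odo_funK c z : cancel (odo_fun c z) (odo_fun (~~ c) z).
Proof.
move=> x; apply/funext => u; rewrite /odo_fun.
by rewrite -/(odo_fun c z x) carry_odo -addbA addbb addbF.
Qed.

Lemma odo_funVK c z : cancel (odo_fun (~~ c) z) (odo_fun c z).
Proof. by rewrite -{2}[c]negbK; exact: odo_funK. Qed.

Lemma flip_funK z : cancel (flip_fun z) (flip_fun z).
Proof. by move=> x; apply/funext => u; rewrite /flip_fun -addbA addbb addbF. Qed.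

Lemma transl_funK p : cancel (transl_fun p) (transl_fun (- p)).
Proof. by move=> x; apply/funext => u; rewrite /transl_fun opprK addrK. Qed.

Lemma transl_funVK p : cancel (transl_fun (- p)) (transl_fun p).
Proof. by rewrite -{2}[p]opprK; exact: transl_funK. Qed.

Definition flip z : sym config := Bijection (@flip_funK z) (@flip_funK z).
Definition transl p : sym config := Bijection (@transl_funK p) (@transl_funVK p).
Definition odo z : sym config := Bijection (@odo_funK true z) (@odo_funVK true z).

Lemma odoE z x : odo z x = odo_fun true z x. Proof. by []. Qed.
Lemma odoV_E z x : (odo z)^-1%g x = odo_fun false z x. Proof. by []. Qed.

Lemma flipE z x u : flip z x u = x u (+) (u == z). Proof. by []. Qed.
Lemma translE p x u : transl p x u = x (u - p). Proof. by []. Qed.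

Lemma flipV z : (flip z)^-1%g = flip z. Proof. exact: symP. Qed.

Lemma translD p u : transl (p + u) = (transl p * transl u)%g.
Proof. by apply: symP => x; apply/funext => v; rewrite symME !translE opprD addrA. Qed.

Lemma transl0 : transl 0 = 1%g.
Proof. by apply: symP => x; apply/funext => v; rewrite translE subr0. Qed.

Lemma translN p : transl (- p) = (transl p)^-1%g.
Proof. by apply: symP => x. Qed.

Lemma translC p u : commute (transl p) (transl u).
Proof. by rewrite /commute -!translD addrC. Qed.

Lemma transl_flip p z : (transl p * flip z)%g = (flip (z + p) * transl p)%g.
Proof.
apply: symP => x; apply/funext => u; rewrite !symME flipE !translE flipE.
by rewrite subr_eq.
Qed.

Lemma up_transl z n p : up z n - p = up (z - p) n.
Proof. by case: z p => [a b] [c d]; rewrite /up /=; congr (_, _); rewrite /=; lia. Qed.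

Lemma carry_transl c z n x p : carry c (z + p) n (transl_fun p x) = carry c z n x.
Proof.
apply/carryP/carryP => H m mn; have := H m mn;
  by rewrite /transl_fun up_transl addrK.
Qed.

Lemma transl_odo_fun c p z x :
  transl_fun p (odo_fun c z x) = odo_fun c (z + p) (transl_fun p x).
Proof.
apply/funext => u; rewrite /transl_fun /odo_fun -/(transl_fun p x).
have -> : on_ray (z + p) u = on_ray z (u - p).
  case: z p u => [a b] [d e] [f g]; rewrite /on_ray /=.
  by apply/andP/andP => -[/eqP h1 h2]; split; [apply/eqP| | apply/eqP|]; lia.
have -> : (u.2 - (z + p).2 = (u - p).2 - z.2)%R.
  by case: z p u => [a b] [d e] [f g] /=; lia.
by rewrite carry_transl.
Qed.

Lemma transl_odo p z : (transl p * odo z)%g = (odo (z + p) * transl p)%g.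
Proof. by apply: symP => x; rewrite !symME /= transl_odo_fun. Qed.

(** Long addition one digit at a time. The comparison with flips, the doubling relation [odo_up1]
    and the cost of a carry are all read off from this recursion. *)
Lemma odo_funE c z x : odo_fun c z x =
  if x z == c then odo_fun c (up z 1) (flip_fun z x) else flip_fun z x.
Proof.
apply/funext => u; case: (boolP (on_ray z u)) => [/on_rayP[[|n] ->]|zu].
- rewrite up0 -{2}[z]up0 odo_up up0 addbT.
  have zz : ~~ on_ray (up z 1) z by rewrite /on_ray /up /= eqxx; lia.
  by case: ifP => _; rewrite ?odo_off // /flip_fun eqxx addbT.
- have nz k : (up (up z 1) k == z) = false.
    by apply/negbTE/eqP; case: z => a b; rewrite /up /= => -[]; lia.
  rewrite odo_up carryS upS; case: ifP => _; rewrite ?odo_up /flip_fun nz addbF //.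
  congr (_ (+) _); apply/carryP/carryP => H m mn; have := H m mn; by rewrite /flip_fun nz addbF.
- have zu1 : ~~ on_ray (up z 1) u.
    by apply: contra zu => /on_rayP[n ->]; apply/on_rayP; exists n.+1; rewrite -upS.
  have uz : (u == z) = false.
    by apply: contraNF zu => /eqP->; apply/on_rayP; exists 0%N; rewrite up0.
  by rewrite odo_off //; case: ifP => _; rewrite ?odo_off // /flip_fun uz addbF.
Qed.

Lemma carry_flip_off c z w n x : ~~ on_ray z w -> carry c z n (flip_fun w x) = carry c z n x.
Proof.
move=> zw; have uw m : (up z m == w) = false.
  by apply: contraNF zw => /eqP <-; apply/on_rayP; exists m.
by apply/carryP/carryP => H m mn; have := H m mn; rewrite /flip_fun uw addbF.
Qed.

Lemma odo_flip_off c z w x : ~~ on_ray z w ->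
  odo_fun c z (flip_fun w x) = flip_fun w (odo_fun c z x).
Proof.
move=> zw; apply/funext => u; rewrite /odo_fun /flip_fun -/(flip_fun w x).
by rewrite carry_flip_off // addbAC.
Qed.

Lemma flip_odo z x : flip z x = if x z then (odo z)^-1%g x else odo z x.
Proof.
by rewrite odoV_E /= [odo_fun false _ _]odo_funE [odo_fun true _ _]odo_funE; case: (x z).
Qed.

Lemma not_on_ray_up z : ~~ on_ray (up z 1) z.
Proof. by rewrite /on_ray /up /= eqxx; lia. Qed.

Lemma odo_up1 z : odo (up z 1) = (odo z * odo z)%g.
Proof.
apply: symP => x; rewrite symME /=.
have rz y : odo_fun true (up z 1) y z = y z by rewrite odo_off ?not_on_ray_up.
case xz : (x z).
  rewrite (odo_funE true z x) xz eqxx [RHS]odo_funE rz /flip_fun eqxx xz /=.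
  by rewrite -/(flip_fun z _) -/(flip_fun z x) odo_flip_off ?not_on_ray_up // flip_funK.
by rewrite (odo_funE true z x) xz /= [RHS]odo_funE /flip_fun eqxx xz /= -/(flip_fun z _) -/(flip_fun z x) flip_funK.
Qed.

Lemma odo_upX z n : odo (up z n) = (odo z ^+ (2 ^ n))%g.
Proof.
elim: n z => [|n IH] z; first by rewrite up0 expg1.
by rewrite upS IH odo_up1 -expg2 -expgnA -expnS.
Qed.

Lemma odo_off_column c z u x : u.1 != z.1 -> odo_fun c z x u = x u.
Proof. by move=> uz; rewrite odo_off // /on_ray (negbTE uz). Qed.

Lemma odo_column c z u x y : (forall v, v.1 = u.1 -> x v = y v) ->
  odo_fun c z x u = odo_fun c z y u.
Proof.
move=> xy; case: (boolP (on_ray z u)) => [/on_rayP[n uE]|zu]; last by rewrite !odo_off ?xy.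
move: xy; rewrite uE !odo_up => xy; rewrite xy //; congr (_ (+) _).
by apply/carryP/carryP => H m mn; have := H m mn; rewrite xy.
Qed.

(** In one column the upper odometer is a power of the lower one, by [odo_upX]; odometers of
    different columns neither read nor change a common site. *)
Lemma odoC z u : commute (odo z) (odo u).
Proof.
case: (eqVneq z.1 u.1) => zu.
  wlog le_zu : z u zu / z.2 <= u.2.
    move=> H; case: (lerP z.2 u.2) => [|/ltW] /H; first exact.
    by move=> K; apply/commute_sym/K.
  have -> : u = up z `|u.2 - z.2|%N.
    by case: z u zu le_zu => [a b] [c d] /= -> bd; rewrite /up /=; congr (_, _); lia.
  by rewrite odo_upX; exact: commuteX.
apply: symP => x; apply/funext => v; rewrite !symME /=.
case: (eqVneq v.1 z.1) => vz.
  rewrite [RHS]odo_off_column ?vz //; apply: odo_column => w wv.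
  by rewrite odo_off_column // wv vz.
rewrite [LHS]odo_off_column //; apply: odo_column => w wv.
by rewrite odo_off_column // wv.
Qed.

Lemma odo_fun_local c z u x y :
  (forall v, v \in u :: [seq up z m | m <- iota 0 `|u.2 - z.2|%N] -> x v = y v) ->
  odo_fun c z x u = odo_fun c z y u.
Proof.
move=> xy; rewrite /odo_fun xy ?mem_head //; congr (_ (+) (_ && _)).
by apply/carryP/carryP => H m mn; have := H m mn; rewrite xy // inE map_f ?orbT // mem_iota.
Qed.

Lemma reach_ind (G : groupType) (S : set G) (P : nat -> G -> Prop) :
  P 0%N 1%g -> (forall k s h, S s -> P k h -> P k.+1 (s * h)%g) ->
  forall k g, reach S k g -> exists2 l, (l <= k)%N & P l g.
Proof.
move=> P0 PS k g [w [wS <-] wk]; exists (size w) => //.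
elim: w wS {wk} => [|s w IH] wS; first by rewrite big_nil.
rewrite big_cons; apply: PS; first by apply: wS; rewrite mem_head.
by apply: IH => t tw; apply: wS; rewrite inE tw orbT.
Qed.

(** * The two generating sets, words and normal forms *)

Definition gamma_gens : seq (sym config) := [:: flip 0; transl (1, 0); transl (0, 1)].
Definition lambda_gens : seq (sym config) := [:: odo 0; transl (1, 0); transl (0, 1)].

Definition box (k : nat) : set site := [set u | `|u.1|%N <= k /\ `|u.2|%N <= k]%N.

Definition box_sites (k : nat) : seq site :=
  let r := [seq (n%:Z - k%:Z) | n <- iota 0 (k + k).+1] in [seq (a, b) | a <- r, b <- r].

Lemma box_sitesP k u : reflect (box k u) (u \in box_sites k).
Proof.
have mr (a : int) : (a \in [seq (n%:Z - k%:Z) | n <- iota 0 (k + k).+1]) = (`|a| <= k)%N.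
  apply/mapP/idP => [[n]|ak]; first by rewrite mem_iota => nk ->; lia.
  by exists (absz (a + k%:Z)); rewrite ?mem_iota; lia.
apply: (iffP allpairsP) => [[[a b] /= [ar br ->]]|[u1 u2]]; first by rewrite !mr in ar br.
by exists u; rewrite !mr; case: (u) u1 u2.
Qed.

Lemma box_sites_uniq k : uniq (box_sites k).
Proof.
have ur : uniq [seq (n%:Z - k%:Z) | n <- iota 0 (k + k).+1].
  by rewrite map_inj_uniq ?iota_uniq // => m n; lia.
by apply: allpairs_uniq => // -[a b] [a' b'] _ _ [-> ->].
Qed.

Lemma box1_transl (s : sym config) : sym_gens [:: transl (1, 0); transl (0, 1)] s ->
  exists2 e, box 1 e & s = transl e.
Proof.
rewrite /sym_gens /= !inE => -[] /orP[] /eqP.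
- by move=> ->; exists (1, 0).
- by move=> ->; exists (0, 1).
- by rewrite -[s in _ -> exists2 _, _ & s = _]invgK => ->; exists (- (1, 0)); rewrite ?translN.
- by rewrite -[s in _ -> exists2 _, _ & s = _]invgK => ->; exists (- (0, 1)); rewrite ?translN.
Qed.

Lemma sym_gens_cons (G : groupType) (a s : G) gens : sym_gens (a :: gens) s ->
  [\/ s = a, s = a^-1%g | sym_gens gens s].
Proof.
rewrite /sym_gens /= !inE => -[] /orP[/eqP|sg].
- by constructor 1.
- by constructor 3; left.
- by move=> <-; constructor 2; rewrite invgK.
- by constructor 3; right.
Qed.

Lemma gamma_gensP s : sym_gens gamma_gens s -> s = flip 0 \/ exists2 e, box 1 e & s = transl e.
Proof.
by case/sym_gens_cons => [->|->|/box1_transl]; [left|left; rewrite flipV|right].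
Qed.

Lemma lambda_gensP s : sym_gens lambda_gens s ->
  [\/ s = odo 0, s = (odo 0)^-1%g | exists2 e, box 1 e & s = transl e].
Proof.
by case/sym_gens_cons => [->|->|/box1_transl]; [constructor 1|constructor 2|constructor 3].
Qed.

Section ReachShift.
Variable a : sym config.
Notation S := (sym_gens [:: a; transl (1, 0); transl (0, 1)]).

Lemma reach_head : reach S 1 a.
Proof. by apply: reach_gen; left; rewrite mem_head. Qed.

Lemma reach_transl p : reach S (`|p.1| + `|p.2|)%N (transl p).
Proof.
have pos (q : site) (n : nat) : transl q \in [:: a; transl (1, 0); transl (0, 1)] ->
    reach S n (transl (q *+ n)) /\ reach S n (transl (- (q *+ n))).
  move=> qS; elim: n => [|n [IH IHV]]; first by rewrite mulr0n oppr0 transl0; split; exact: reach1.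
  have Sq : S (transl q) by left.
  rewrite mulrS opprD !translD -addn1 addnC; split; apply: reachM => //; apply: reach_gen => //.
  by rewrite translN; exact: sym_gensV.
have mem1 : transl (1, 0) \in [:: a; transl (1, 0); transl (0, 1)] by rewrite !inE eqxx orbT.
have mem2 : transl (0, 1) \in [:: a; transl (1, 0); transl (0, 1)] by rewrite !inE eqxx !orbT.
have mulE (q : site) n : q *+ n = (q.1 *+ n, q.2 *+ n).
  by elim: n => // n IH; rewrite mulrS IH !mulrS.
have -> : p = (p.1, 0) + (0, p.2) :> site by case: p => b c; congr (_, _); rewrite /= ?addr0 ?add0r.
rewrite translD; apply: reachM; rewrite /= ?addr0 ?add0r.
  have [h1 h2] := pos _ `|p.1|%N mem1; case: (lerP 0 p.1) => p0.
    by move: h1; rewrite mulE /= mul0rn; congr (reach _ _ (transl _)); congr (_, _); lia.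
  by move: h2; rewrite mulE /= mul0rn; congr (reach _ _ (transl _)); congr (_, _); rewrite /=; lia.
have [h1 h2] := pos _ `|p.2|%N mem2; case: (lerP 0 p.2) => p0.
  by move: h1; rewrite mulE /= mul0rn; congr (reach _ _ (transl _)); congr (_, _); lia.
by move: h2; rewrite mulE /= mul0rn; congr (reach _ _ (transl _)); congr (_, _); rewrite /=; lia.
Qed.

End ReachShift.

Lemma reach_flip z : exists k, reach (sym_gens gamma_gens) k (flip z).
Proof.
have -> : flip z = (transl z * flip 0 * (transl z)^-1)%g by rewrite transl_flip add0r mulgK.
eexists; apply: reachM; [apply: reachM; [exact: reach_transl|exact: reach_head]|].
by rewrite -translN; exact: reach_transl.
Qed.

Lemma reach_odo z : exists k, reach (sym_gens lambda_gens) k (odo z).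
Proof.
have -> : odo z = (transl z * odo 0 * (transl z)^-1)%g by rewrite transl_odo add0r mulgK.
eexists; apply: reachM; [apply: reachM; [exact: reach_transl|exact: reach_head]|].
by rewrite -translN; exact: reach_transl.
Qed.

(** The length [k] depends on [L] alone and not on [f]; this uniformity later bounds the cells of
    the cover. *)
Lemma reach_flips (L : seq site) : exists k, forall f : config, (forall u, f u -> u \in L) ->
  exists2 g, reach (sym_gens gamma_gens) k g & forall x u, g x u = f u (+) x u.
Proof.
elim: L => [|z L [k Hk]].
  exists 0%N => f f0; exists 1%g; first exact: reach1.
  by move=> x u; rewrite sym1E; case fu: (f u) => //; have := f0 u fu.
have [l Hl] := reach_flip z; exists (l + k)%N => f fL.
have [g gk gE] : exists2 g, reach (sym_gens gamma_gens) k g &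
    forall x u, g x u = (f u && (u != z)) (+) x u.
  by apply: Hk => u /andP[/fL]; rewrite inE => /orP[->|].
case fz: (f z).
  exists (flip z * g)%g; first exact: reachM.
  by move=> x u; rewrite symME flipE gE; case: (eqVneq u z) => [->|_]; rewrite ?fz ?andbF ?andbT ?addbT ?addbF.
exists g; first by apply: reach_le gk; exact: leq_addl.
by move=> x u; rewrite gE; case: (eqVneq u z) => [->|_]; rewrite ?fz ?andbF ?andbT.
Qed.

(** Here [p] is the position of the lamplighter and [f] marks the switched lamps; a word of length
    [k] leaves both in the box of radius [k]. *)
Lemma gamma_form k g : reach (sym_gens gamma_gens) k g ->
  exists p (f : config), [/\ box k p, forall u, f u -> box k u & forall x u, g x u = f u (+) x (u - p)].
Proof.
pose P (k : nat) (g : sym config) := exists p (f : config),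
  [/\ box k p, forall u, f u -> box k u & forall x u, g x u = f u (+) x (u - p)].
have Pmono m n h : (m <= n)%N -> P m h -> P n h.
  have bmn u : (m <= n)%N -> box m u -> box n u.
    by move=> mn [h1 h2]; split; exact: leq_trans mn.
  by move=> mn [p [f [pm fm hE]]]; exists p, f; split => // [|u /fm]; exact: bmn.
have box_triangle m n p q : box m p -> box n q -> box (m + n) (p + q).
  by rewrite /box; case: p q => [a b] [c d] /=; lia.
move=> /(@reach_ind _ _ P) [||l lk]; last exact: Pmono.
  exists 0, (fun=> false); split => // x u; by rewrite sym1E subr0.
move=> {k}k s h /gamma_gensP[->|[e e1 ->]] Ph.
  have [p [f [pk fk hE]]] := Pmono _ _ _ (leqnSn k) Ph.
  exists p, (fun u => f u (+) (u == 0)); split => // [u|x u].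
    case: (eqVneq u 0) => [-> _|_]; first by split.
    by rewrite addbF => /fk.
  by rewrite symME flipE hE addbAC.
have {Ph}[p [f [pk fk hE]]] := Ph.
exists (e + p), (fun u => f (u - e)); rewrite -add1n; split => [|u /fk uk|x u].
- exact: box_triangle.
- by rewrite -[u](subrK e) addrC; exact: box_triangle.
- by rewrite symME translE hE opprD addrA.
Qed.

(** * Generic configurations, freeness and equality of orbits *)

Definition almost_eq (x y : config) := exists L : seq site, forall u, u \notin L -> x u = y u.

Lemma almost_eq_sym x y : almost_eq x y -> almost_eq y x.
Proof. by move=> [L H]; exists L => u /H. Qed.

Lemma almost_eq_trans y x (w : config) : almost_eq x y -> almost_eq y w -> almost_eq x w.
Proof.
move=> [L HL] [M HM]; exists (L ++ M) => u; rewrite mem_cat negb_or => /andP[/HL-> /HM->] //.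
Qed.

(** The direction [(0, 1)] makes every carry stop, and all directions together exclude periods.
    Quantifying over every starting point [z] makes the set stable under finite changes, as a ray
    can be started beyond them. *)
Definition good : set config :=
  [set x | forall z p, p != 0 -> exists n : nat, x (z + p *+ n) != x z].

Lemma mulrn_site_inj p : p != 0 -> injective (fun n : nat => p *+ n).
Proof.
move=> p0.
have mulE (q : site) n : q *+ n = (q.1 *+ n, q.2 *+ n).
  by elim: n => // n IH; rewrite mulrS IH !mulrS.
move=> m n; rewrite !mulE => -[/eqP h1 /eqP h2].
case: (eqVneq p.1 0) => p1; last first.
  by have := mulrIn p1 (eqP h1).
have p2 : p.2 != 0 by apply: contraNneq p0 => p2; rewrite [p]surjective_pairing p1 p2.
exact: mulrIn p2 _ _ (eqP h2).
Qed.

Lemma ray_leaves p z (L : seq site) : p != 0 ->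
  exists N : nat, forall n, (N <= n)%N -> z + p *+ n \notin L.
Proof.
move=> p0; elim: L => [|w L [N HN]]; first by exists 0%N.
have [[m mw]|nom] := pselect (exists m : nat, z + p *+ m = w); last first.
  by exists N => n Nn; rewrite inE negb_or HN // andbT; apply/eqP => e; apply: nom; exists n.
exists (N + m.+1)%N => n Nn; rewrite inE negb_or HN ?andbT; last by lia.
apply/eqP; rewrite -mw => /addrI /(mulrn_site_inj p0); lia.
Qed.

Lemma good_almost_eq x y : almost_eq x y -> good x -> good y.
Proof.
move=> [L HL] gx z p p0.
apply: contrapT => noy.
have ycst n : y (z + p *+ n) = y z.
  by apply: contrapT => yn; apply: noy; exists n; apply/eqP.
have [N HN] := ray_leaves z L p0.
have [n] := gx (z + p *+ N) p p0.
by rewrite -addrA -mulrnDr !HL ?HN ?leq_addr // !ycst eqxx.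
Qed.

Lemma good_transl p x : good x -> good (transl p x).
Proof.
move=> gx z q q0; have [n] := gx (z - p) q q0; exists n.
by rewrite !translE addrAC.
Qed.

(** If the shift by [p] changes only finitely many sites, [x] is constant along a ray of direction
    [p] that starts beyond them. *)
Lemma good_aperiodic p x : good x -> almost_eq (transl p x) x -> p = 0.
Proof.
move=> gx [L HL]; apply/eqP; apply: contrapT => /negP p0.
have [N HN] := ray_leaves 0 L p0.
have [n] := gx (0 + p *+ N) p p0; apply/negP; rewrite negbK; apply/eqP.
elim: n => [|n IH]; first by rewrite mulr0n addr0.
have <- : x (0 + p *+ N + p *+ n.+1 - p) = x (0 + p *+ N + p *+ n.+1).
  by rewrite -translE HL // -addrA -mulrnDr HN // leq_addr.
by rewrite mulrSr addrA addrK.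
Qed.

Lemma odo_almost_eq c z x : good x -> almost_eq (odo_fun c z x) x.
Proof.
have upE n : up z n = z + (0, 1) *+ n.
  have -> : (0, 1) *+ n = (0, n%:Z) :> site.
    by elim: n => // n IH; rewrite mulrS IH /=; congr (_, _) => /=; lia.
  by rewrite /up; case: z => a b; congr (_, _); rewrite /= ?addr0.
move=> gx; have [k xk] : exists k, x (up z k) != c.
  have [//|n] := gx z (0, 1); rewrite -upE => xn.
  case: (eqVneq (x z) c) => xz; last by exists 0%N; rewrite up0.
  by exists n; rewrite -xz.
exists [seq up z n | n <- iota 0 k.+1] => u uL.
case: (boolP (on_ray z u)) => [/on_rayP[n uE]|]; last exact: odo_off.
have kn : (k < n)%N.
  rewrite ltnNge; apply: contra uL => nk; rewrite uE; apply: map_f.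
  by rewrite mem_iota.
by rewrite uE odo_up; case: carryP => [/(_ k kn)/eqP|]; rewrite ?addbF // (negbTE xk).
Qed.

Definition odo_sign (c : bool) z : sym config := if c then odo z else (odo z)^-1%g.

Lemma odo_signE c z x : odo_sign c z x = odo_fun c z x.
Proof. by case: c. Qed.

(** The abelian part of the second group. Translations carry odometers to odometers, so each element
    of the group is a translation followed by such a product. *)
Inductive odo_product : sym config -> Prop :=
| odo_product1 : odo_product 1%g
| odo_productM c z b : odo_product b -> odo_product (odo_sign c z * b)%g.

Lemma transl_odo_sign c p z : (transl p * odo_sign c z = odo_sign c (z + p) * transl p)%g.
Proof. by apply: symP => x; rewrite !symME !odo_signE /= transl_odo_fun. Qed.

Lemma odo_signC c z d u : commute (odo_sign c z) (odo_sign d u).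
Proof.
have C := odoC z u; case: c d => -[] //=; do ?exact: commuteV.
  by apply/commute_sym/commuteV/commute_sym.
by apply/commuteV/commute_sym/commuteV/commute_sym.
Qed.

Lemma odo_product_transl p b : odo_product b -> odo_product (transl p * b * (transl p)^-1)%g.
Proof.
elim=> [|c z {}b _ IH]; first by rewrite mulg1 mulgV; exact: odo_product1.
have -> : (transl p * (odo_sign c z * b) / transl p = odo_sign c (z + p) * (transl p * b / transl p))%g.
  by rewrite !mulgA -transl_odo_sign.
exact: odo_productM.
Qed.

Lemma lambda_form k g : reach (sym_gens lambda_gens) k g ->
  exists p b, odo_product b /\ g = (b * transl p)%g.
Proof.
move=> /(@reach_ind _ _ (fun _ g => exists p b, odo_product b /\ g = b * transl p)%g) [||l _ //].
  by exists 0, 1%g; split; [exact: odo_product1|rewrite transl0 mul1g].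
move=> {k}k s h Ss [p [b [bP ->]]].
have [->|->|[e _ ->]] := lambda_gensP Ss.
- by exists p, (odo 0 * b)%g; split; [exact: (odo_productM true)|rewrite mulgA].
- by exists p, ((odo 0)^-1 * b)%g; split; [exact: (odo_productM false)|rewrite mulgA].
- exists (e + p), (transl e * b / transl e)%g; split; first exact: odo_product_transl.
  by rewrite translD !mulgA mulgVK.
Qed.

Lemma odo_product_almost_eq b x : odo_product b -> good x -> almost_eq (b x) x.
Proof.
move=> bP gx; elim: bP => [|c z {}b _ IH]; first by exists [::].
apply: (almost_eq_trans _ (IH)); rewrite symME odo_signE; apply: odo_almost_eq.
exact: good_almost_eq (almost_eq_sym IH) gx.
Qed.

Lemma odo_product_comm b d : odo_product b -> odo_product d -> commute b d.
Proof.
move=> bP; elim=> [|c z {}d _ IH]; first exact: commute1.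
apply: commuteM => //; apply: commute_sym.
by elim: bP {IH} => [|c' z' {}b _ IH]; [exact: commute1|apply: commuteM; [exact: odo_signC|]].
Qed.

Lemma odo_product_local b u : odo_product b ->
  exists L : seq site, forall x y, {in L, x =1 y} -> b x u = b y u.
Proof.
move=> bP; elim: bP u => [|c z {}b _ IH] u; first by exists [:: u] => x y; apply; rewrite mem_head.
have [L HL] : exists L : seq site, forall v, v \in u :: [seq up z m | m <- iota 0 `|u.2 - z.2|%N] ->
    forall x y, {in L, x =1 y} -> b x v = b y v.
  elim: (u :: _) => [|v M [L HL]]; first by exists [::].
  have [L' HL'] := IH v; exists (L ++ L') => w; rewrite inE => /orP[/eqP->|wM] x y xy.
    by apply: HL' => t tL; apply: xy; rewrite mem_cat tL orbT.
  by apply: HL => // t tL; apply: xy; rewrite mem_cat tL.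
exists L => x y xy; rewrite !symME !odo_signE; apply: odo_fun_local => v vu; exact: HL.
Qed.

(** One site is corrected at a time: of the odometer at [v] and its inverse, the one that meets no
    carry acts as a flip and keeps the sites treated before. *)
Lemma odo_product_approx (M : seq site) x y :
  exists2 d, odo_product d & {in M, d x =1 y}.
Proof.
elim: M => [|v M [d dP dM]]; first by exists 1%g => //; exact: odo_product1.
case: (eqVneq (d x v) (y v)) => dv.
  by exists d => // w; rewrite inE => /orP[/eqP->|/dM].
exists (odo_sign (~~ d x v) v * d)%g; first exact: odo_productM.
have -> : (odo_sign (~~ d x v) v * d)%g x = flip v (d x).
  by rewrite symME flip_odo; case: (d x v).
move=> w; rewrite inE flipE; case: (eqVneq w v) => [->|wv] /=; last by rewrite addbF => /dM.
by rewrite addbT; case: (d x v) dv; case: (y v).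
Qed.

(* A product of odometers is determined by its value at a single point: it
   commutes with all such products, whose orbits are dense, and it is continuous. *)
Lemma odo_product_free b x : odo_product b -> b x = x -> b = 1%g.
Proof.
move=> bP bx; apply: symP => y; apply/funext => u; rewrite sym1E.
have [L HL] := odo_product_local u bP.
have [d dP dL] := odo_product_approx (u :: L) x y.
have <- : d x u = y u by apply: dL; rewrite mem_head.
rewrite -(HL (d x)); last by move=> v vL; apply: dL; rewrite inE vL orbT.
by rewrite -symME (odo_product_comm bP dP) symME bx.
Qed.

Lemma lambda_free k g x : reach (sym_gens lambda_gens) k g -> good x -> g x = x -> g = 1%g.
Proof.
move=> /lambda_form[p [b [bP ->]]] gx gxx.
have p0 : p = 0.
  apply: (good_aperiodic gx); rewrite -{2}gxx symME; apply/almost_eq_sym.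
  by apply: odo_product_almost_eq => //; exact: good_transl.
by move: gxx; rewrite p0 transl0 mulg1 => /(odo_product_free bP).
Qed.

Lemma gamma_free k g x : reach (sym_gens gamma_gens) k g -> good x -> g x = x -> g = 1%g.
Proof.
move=> /gamma_form[p [f [_ fk gE]]] gx gxx.
have p0 : p = 0.
  apply: (good_aperiodic gx).
  exists (box_sites k) => u uL; rewrite translE -{2}gxx gE.
  by case fu: (f u) => //; move: uL; rewrite (introT (box_sitesP _ _) (fk _ fu)).
apply: symP => y; apply/funext => u; rewrite sym1E gE p0 subr0.
have := gE x u; rewrite gxx p0 subr0 => xu.
by have -> : f u = false by case: (f u) (x u) xu => -[].
Qed.

(** Each flip in a word becomes the odometer or its inverse, chosen by the bit met at that moment.
    The length does not change, so these distances are bounded. *)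
Lemma gamma_orbit_lambda k g x : reach (sym_gens gamma_gens) k g ->
  exists2 h, reach (sym_gens lambda_gens) k h & h x = g x.
Proof.
move=> gk; pose P (k : nat) (g : sym config) := forall x,
  exists2 h, reach (sym_gens lambda_gens) k h & h x = g x.
have [||l lk /(_ x)[h hl hx]] := @reach_ind _ _ P _ _ k g gk.
- by move=> y; exists 1%g => //; exact: reach1.
- move=> {gk}k s {}g sS Pg y; have [h hk hy] := Pg y; rewrite -add1n.
  have [->|sE] : s = flip 0 \/ sym_gens lambda_gens s.
    case/sym_gens_cons: sS => [->|->|sT]; [by left|by left; rewrite flipV|right].
    by case: sT => sT; [left|right]; rewrite inE sT orbT.
    exists (odo_sign (~~ h y 0) 0 * h)%g.
      apply: reachM => //; apply: reach_gen; case: (h y 0) => /=; [right|left].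
        by rewrite invgK mem_head.
      by rewrite mem_head.
    by rewrite !symME -hy flip_odo; case: (h y 0).
  exists (s * h)%g; last by rewrite !symME hy.
  by apply: reachM => //; exact: reach_gen.
- by exists h => //; exact: reach_le hl.
Qed.

Lemma almost_transl_gamma p x y : almost_eq y (transl p x) ->
  exists k, exists2 g, reach (sym_gens gamma_gens) k g & g x = y.
Proof.
move=> [L HL]; have [k Hk] := reach_flips L.
have [u|g gk gE] := Hk (fun u => y u (+) transl p x u).
  by apply: contraTT => /HL ->; rewrite addbb.
exists (k + (`|p.1| + `|p.2|))%N, (g * transl p)%g; first by apply: reachM => //; exact: reach_transl.
by apply/funext => u; rewrite symME gE -addbA addbb addbF.
Qed.

Lemma lambda_orbit_gamma k h x : reach (sym_gens lambda_gens) k h -> good x ->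
  exists l, exists2 g, reach (sym_gens gamma_gens) l g & g x = h x.
Proof.
move=> /lambda_form[p [b [bP ->]]] gx; apply: (@almost_transl_gamma p).
by rewrite symME; apply: odo_product_almost_eq => //; exact: good_transl.
Qed.

(** Each digit carried over costs a flip, a shift bringing the next digit to the origin and a shift
    back, hence [3 * n]; the digit where the carry stops costs one flip. *)
Lemma odo_gamma c n x : (exists2 m, (m <= n)%N & x (up 0 m) != c) ->
  exists2 g, reach (sym_gens gamma_gens) (3 * n + 1) g & g x = odo_fun c 0 x.
Proof.
elim: n x => [|n IH] x [m mn xm].
  move: mn xm; rewrite leqn0 => /eqP->; rewrite up0 => x0.
  exists (flip 0); first exact: reach_head.
  by rewrite odo_funE (negbTE x0).
case: (eqVneq (x 0) c) => x0; last first.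
  exists (flip 0); first by apply: reach_le (reach_head _); lia.
  by rewrite odo_funE (negbTE x0).
pose t := transl (0, 1).
have t0 (y : config) : t^-1%g y = transl_fun (- (0, 1)) y by [].
case: m mn xm => [|m] mn xm; first by rewrite up0 x0 eqxx in xm.
have [|g gk gE] := IH (t^-1 (flip 0 x))%g.
  exists m => //; rewrite t0 /transl_fun opprK flipE.
  have -> : up 0 m + (0, 1) = up 0 m.+1 by rewrite /up /=; congr (_, _) => /=; lia.
  by rewrite (_ : up 0 m.+1 == 0 = false) ?addbF //; apply/eqP => -[].
exists (t * g * t^-1 * flip 0)%g.
  have rt : reach (sym_gens gamma_gens) 1 t by exact: (reach_transl _ (0, 1)).
  apply: (@reach_le _ _ (1 + (3 * n + 1) + 1 + 1)%N); first by lia.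
  apply: reachM; last exact: reach_head.
  by apply: reachM; [exact: reachM|apply: reachV => //; exact: sym_gensV].
rewrite !symME gE -[t _]/(transl_fun _ _) transl_odo_fun [RHS]odo_funE x0 eqxx.
have -> : 0 + (0, 1) = up 0 1 by [].
by rewrite -[transl_fun _ _]/(t _) t0 -[t _]/(transl_fun (0, 1) _) transl_funVK.
Qed.

(** * Asymptotic dimension of the two groups *)

Lemma transl_inj : injective transl.
Proof.
move=> p q pq; have := congr1 (fun g : sym config => g (fun u => u == 0) p) pq.
by rewrite /= /transl_fun subrr eqxx => /esym/eqP/subr0_eq.
Qed.

Lemma odo_expg_bit z n x : (odo z ^+ n)%g x z = x z (+) odd n.
Proof.
elim: n => [|n IH]; first by rewrite addbF.
have ob y : odo z y z = ~~ y z by have := odo_up true z 0 y; rewrite up0 addbT.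
by rewrite expgS symME ob IH /= addbN.
Qed.

(** An odd power changes the bit at [z]; an even power of [odo z] is the half power of
    [odo (up z 1)], whence the descent. *)
Lemma odo_expg_neq1 z n : (0 < n)%N -> (odo z ^+ n)%g != 1%g.
Proof.
elim/ltn_ind: n z => n IH z n0; apply/eqP => e.
have nev : ~~ odd n.
  have := odo_expg_bit z n (fun=> false); rewrite e sym1E; by case: odd.
have n2 : n = (2 * n./2)%N by rewrite mul2n even_halfK.
have := IH n./2 _ (up z 1); rewrite odo_up1 -expg2 -expgnA -n2 e eqxx.
by move=> H; have : ~~ true by apply: H; lia.
Qed.

Lemma odo_expg_inj z : injective (fun n : nat => odo z ^+ n)%g.
Proof.
move=> m n; wlog mn : m n / (m <= n)%N.
  by move=> H; case: (leqP m n) => [|/ltnW] mn e; [exact: H|exact/esym/H].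
move=> e; have := expgnFr (odo z) mn; rewrite -e mulgV => d1.
case: (posnP (n - m)) => [|/(odo_expg_neq1 z)]; last by rewrite d1 eqxx.
by move=> d0; apply/eqP; rewrite eqn_leq mn -subn_eq0 d0.
Qed.

Lemma odo_expg_off_column z n u x : u.1 != z.1 -> (odo z ^+ n)%g x u = x u.
Proof.
move=> uz; elim: n => [|n IH] //.
by rewrite expgS symME odoE odo_off_column.
Qed.

Lemma odo_expg_column z n u x y : (forall v, v.1 = u.1 -> x v = y v) ->
  (odo z ^+ n)%g x u = (odo z ^+ n)%g y u.
Proof.
elim: n u => [|n IH] u xy; first exact: xy.
rewrite expgS !symME !odoE; apply: odo_column => v vu; apply: IH => w wv; apply: xy.
by rewrite wv.
Qed.

(** Columns do not interact, so the exponents of a monomial can be recovered one column at a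
    time. *)
Lemma odo_monomial_column (m : nat) (r : seq 'I_m) (a : 'I_m -> nat) (i : 'I_m) x u :
  uniq r -> u.1 = i%:Z ->
  (\prod_(j <- r) odo (j%:Z, 0%R) ^+ a j)%g x u =
  if i \in r then (odo (i%:Z, 0%R) ^+ a i)%g x u else x u.
Proof.
elim: r u => [|j r IH] u; first by rewrite big_nil.
rewrite big_cons inE => /andP[jr ur] ui; rewrite symME.
case: (eqVneq i j) => [ij|ij] /=; last first.
  rewrite odo_expg_off_column ?IH //= ui; apply/eqP => -[ij'].
  by rewrite (val_inj ij') eqxx in ij.
rewrite -ij; apply: odo_expg_column => v vu; rewrite IH ?vu //.
by rewrite -ij in jr; rewrite (negbTE jr).
Qed.


Lemma val_monomial (gens : seq (sym config)) n (t : 'I_n.+1 -> gsub gens) (a : {ffun 'I_n.+1 -> nat}) :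
  val (monomial t a) = (\prod_i val (t i) ^+ a i)%g.
Proof.
rewrite /monomial (big_morph val (@valM _ _ _) (@val1 _ _ _)).
by apply: eq_bigr => i _; rewrite gmulfXn.
Qed.

Section Asdim.
Variable R : realType.

Lemma Lambda_asdim_le k : ~ asdim_le (word_dist R (gsub_gens lambda_gens)) k.
Proof.
have /choice[t tE] : forall i : 'I_k.+1, exists h : gsub lambda_gens, val h = odo (i%:Z, 0).
  by move=> i; have [l /gsub_reach[h hE _]] := reach_odo (i%:Z, 0); exists h.
move=> /(@asdim_le_commuting _ _ _ _ t (gsub_generating _)) H.
have : (k < k)%N; last by rewrite ltnn.
apply: H => [i j|a b /(congr1 val)].
  by apply: val_inj; rewrite !valM !tE; exact: odoC.
rewrite !val_monomial; under eq_bigr do rewrite tE; under [in RHS]eq_bigr do rewrite tE.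
move=> ab; apply/ffunP => i; apply: (@odo_expg_inj (i%:Z, 0)); apply: symP => x; apply/funext => u.
case: (eqVneq u.1 i%:Z) => ui; last by rewrite !odo_expg_off_column.
have := congr1 (fun g : sym config => g x u) ab.
by rewrite !(@odo_monomial_column _ _ _ i) ?index_enum_uniq // !mem_index_enum.
Qed.

Lemma Gamma_asdim_ge k : asdim_le (word_dist R (gsub_gens gamma_gens)) k -> (2 <= k)%N.
Proof.
pose e (i : 'I_2) : site := if i == ord0 then (1, 0) else (0, 1).
have /choice[t tE] : forall i : 'I_2, exists h : gsub gamma_gens, val h = transl (e i).
  by move=> i; have /gsub_reach[h hE _] := reach_transl (flip 0) (e i); exists h.
apply: (@asdim_le_commuting _ _ _ _ t (gsub_generating _)) => [i j|a b /(congr1 val)].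
  by apply: val_inj; rewrite !valM !tE; exact: translC.
rewrite !val_monomial; under eq_bigr do rewrite tE; under [in RHS]eq_bigr do rewrite tE.
have translX p n : (transl p ^+ n = transl (p *+ n))%g.
  by elim: n => [|n IH]; rewrite ?transl0 // expgS IH mulrS translD.
have mulE (q : site) n : q *+ n = (q.1 *+ n, q.2 *+ n).
  by elim: n => // n IH; rewrite mulrS IH !mulrS.
rewrite !big_ord_recl !big_ord0 !mulg1 !translX -!translD => /transl_inj.
rewrite !mulE /e /= !mul0rn => -[]; rewrite ?addr0 ?add0r => h1 h2; apply/ffunP => i.
rewrite !natz in h1 h2; case: (unliftP ord0 i) => [j ->|->]; last by case: h1.
by rewrite (ord1 j); case: h2.
Qed.

(** * Upper bound for the asymptotic dimension of the lamplighter group *)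

Lemma gamma_form_uniq p q (f g : config) :
  (forall x u, f u (+) x (u - p) = g u (+) x (u - q)) -> p = q /\ f = g.
Proof.
move=> H; have fg : f = g by apply/funext => u; have := H (fun=> false) u; rewrite !addbF.
split=> //; have := H (fun u => u == 0) p; rewrite fg subrr eqxx => /addbI/esym/eqP.
by move/subr0_eq.
Qed.

(* Bricks of width [2 L] and height [L], each row being offset by [L] from the
   previous one: bricks of the same colour do not touch. *)
Definition brick (L : int) p : int * int :=
  let j := (p.2 %/ L)%Z in (((p.1 - L * j) %/ (2 * L))%Z, j).

(** The bricks touching [(i, j)] are [(i + 1, j)], [(i - 1, j)], [(i, j + 1)], [(i - 1, j + 1)],
    [(i, j - 1)] and [(i + 1, j - 1)]. For all six, [i - j] changes by 1 or 2 in absolute value,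
    hence not by a multiple of 3. *)
Definition brick_colour (b : int * int) : 'I_3 := inord `|((b.1 - b.2) %% 3)%Z|%N.

Lemma brickP (L : int) p : 0 < L ->
  L * (brick L p).2 <= p.2 < L * (brick L p).2 + L /\
  2 * L * (brick L p).1 <= p.1 - L * (brick L p).2 < 2 * L * (brick L p).1 + 2 * L.
Proof.
move=> L0; rewrite /brick /=; set j := (p.2 %/ L)%Z.
have L2 : 0 < 2 * L by lia.
have Ln : L != 0 by lia.
have L2n : 2 * L != 0 by lia.
have := divz_eq p.2 L; have := modz_ge0 p.2 Ln; have := ltz_pmod p.2 L0.
have := divz_eq (p.1 - L * j) (2 * L); have := modz_ge0 (p.1 - L * j) L2n.
have := ltz_pmod (p.1 - L * j) L2.
rewrite -/j; set i := ((p.1 - L * j) %/ (2 * L))%Z; lia.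
Qed.

Lemma brick_separated (L : int) (k : nat) p q : k%:Z < L -> box k (q - p) ->
  brick_colour (brick L p) = brick_colour (brick L q) -> brick L p = brick L q.
Proof.
move=> kL [d1 d2] /(congr1 val); rewrite /brick_colour.
have L0 : 0 < L by lia.
have [] := brickP p L0; have [] := brickP q L0.
case: (brick L p) (brick L q) => [i j] [i' j'] /= jq iq jp ip.
rewrite !inordK; last 2 first.
- by lia.
- by lia.
move: d1 d2; case: p q jq iq jp ip => [a b] [c d] /= jq iq jp ip d1 d2 cE.
have ab1 : `|c - a| <= k%:Z by lia.
have ab2 : `|d - b| <= k%:Z by lia.
have j1 : j' - j <= 1 by nia.
have j2 : j - j' <= 1 by nia.
have [jE|[jE|jE]] : j' = j \/ j' = j + 1 \/ j' = j - 1 by lia.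
- have : i' - i <= 1 by rewrite jE in iq; nia.
  have : i - i' <= 1 by rewrite jE in iq; nia.
  by rewrite jE in cE *; move=> h1 h2; congr (_, _); lia.
- have : i' - i <= 0 by rewrite jE in iq; nia.
  have : i - i' <= 1 by rewrite jE in iq; nia.
  by rewrite jE in cE *; lia.
- have : i' - i <= 1 by rewrite jE in iq; nia.
  have : i - i' <= 0 by rewrite jE in iq; nia.
  by rewrite jE in cE *; lia.
Qed.

Lemma brick_bounded (L : int) p q : 0 < L -> brick L p = brick L q ->
  box (absz (2 * L)%R) (q - p).
Proof.
move=> L0 pq; have [] := brickP p L0; have [] := brickP q L0.
rewrite pq; case: (brick L q) => [i j] /=.
by case: p q {pq} => [a b] [c d]; rewrite /box /=; lia.
Qed.

Section GammaUpperBound.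
Variables (pos : gsub gamma_gens -> site) (cf : gsub gamma_gens -> config).
Hypothesis gammaE : forall (h : gsub gamma_gens) x u, val h x u = cf h u (+) x (u - pos h).

Lemma gamma_step (h h' : gsub gamma_gens) k : reach (gsub_gens gamma_gens) k (h^-1 * h')%g ->
  box k (pos h' - pos h) /\ forall u, cf h' u != cf h u -> box k (u - pos h).
Proof.
move=> /reach_val/gamma_form[p [f [pk fk fE]]].
have [] := @gamma_form_uniq (pos h') (pos h + p) (cf h') (fun u => cf h u (+) f (u - pos h)).
  move=> x u; rewrite -gammaE -addbA -(mulVKg h h') valM symME gammaE fE.
  by rewrite opprD addrA.
move=> -> ->; split=> [|u]; first by rewrite addrC addKr.
by move=> uf; apply: fk; case: (cf h u) (f _) uf => -[].
Qed.

Lemma gamma_bounded (k : nat) : exists D, forall h h' : gsub gamma_gens, box k (pos h' - pos h) ->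
  (forall u, cf h' u != cf h u -> box k (u - pos h)) ->
  reach (gsub_gens gamma_gens) D (h^-1 * h')%g.
Proof.
have [D HD] := reach_flips (box_sites k); exists (D + (k + k))%N => h h' hk fk.
have [u|g gD gE] := HD (fun u => cf h' (u + pos h) (+) cf h (u + pos h)).
  by move=> e; apply/box_sitesP; rewrite -[u](addrK (pos h)); apply: fk; move: e; case: (cf h' _) (cf h _) => -[].
apply: val_reach; rewrite (_ : val _ = g * transl (pos h' - pos h))%g.
  apply: reachM => //; apply: reach_le (reach_transl _ _).
  by case: hk => h1 h2; rewrite leq_add.
apply: symP => x; apply: (can_inj (@sym_funK _ (val h))).
have -> : val h (val (h^-1 * h')%g x) = val h' x by rewrite -symME -valM mulVKg.
apply/funext => u; rewrite !gammaE symME gE subrK translE opprB addrA addrNK.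
by case: (cf h u); case: (cf h' u); case: (x _).
Qed.

End GammaUpperBound.

(** A word of length at most [k] applied in a given brick changes lamps only within [k] of that
    brick. Fixing the brick and the lamps far from it thus gives pieces that are separated within a
    colour, and bounded because finitely many lamps remain free. *)
Lemma Gamma_asdim_le2 : asdim_le (word_dist R (gsub_gens gamma_gens)) 2.
Proof.
have /choice[pf pfE] : forall h : gsub gamma_gens, exists pf : site * config,
    forall x u, val h x u = pf.2 u (+) x (u - pf.1).
  by move=> h; have [k /gamma_form[p [f [_ _ fE]]]] := reach_gsub h; exists (p, f).
pose pos h := (pf h).1; pose cf h := (pf h).2.
have gammaE (h : gsub gamma_gens) x u : val h x u = cf h u (+) x (u - pos h) by exact: pfE.
move=> r r0; have [k Hk] := word_length_reach_bound (gsub_gens gamma_gens) r.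
pose L : int := k.+1%:Z.
have L0 : 0 < L by [].
(* A cell prescribes the brick of the lamplighter and the lamps away from it. *)
pose near (b : int * int) u := exists2 p, brick L p = b & box k (u - p).
pose cell b (f : config) : set (gsub gamma_gens) :=
  [set h | brick L (pos h) = b /\ forall u, ~ near b u -> cf h u = f u].
(* A lamp that may differ is within [k] of a point of the brick, which is within [2 * L] of the
   lamplighter. *)
have [D HD] := gamma_bounded gammaE (k + absz (2 * L)%R)%N.
exists (fun c => [set A | exists b f, brick_colour b = c /\ A = cell b f]), D%:R; split.
- move=> h; exists (brick_colour (brick L (pos h))), (cell (brick L (pos h)) (cf h)).
  by split => //; exists (brick L (pos h)), (cf h).
- move=> c _ h h' [b [f [_ ->]]] [hb hf] [hb' hf']; apply: reach_word_length.
  have bh : box (absz (2 * L)%R) (pos h' - pos h) by apply: brick_bounded; rewrite ?hb.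
  apply: HD => [|u cu].
    by case: bh; rewrite /box /= => h1 h2; split; lia.
  have [p pb [up1 up2]] : near b u.
    by apply: contrapT => nu; move: cu; rewrite hf // hf' // eqxx.
  have [b1 b2] : box (absz (2 * L)%R) (p - pos h) by apply: brick_bounded; rewrite ?hb.
  by move: up1 up2 b1 b2; rewrite /box; case: (u) (p) (pos h) => [u1 u2] [p1 p2] [q1 q2] /=; lia.
- move=> c _ _ h h' [b [f [bc ->]]] [b' [f' [bc' ->]]] bb [hb hf] [hb' hf'].
  rewrite ltNge; apply/negP => /Hk/(gamma_step gammaE)[hk fk].
  have bE : b = b'.
    by rewrite -hb -hb'; apply: (brick_separated _ hk); [rewrite /L; lia|rewrite hb hb' bc bc'].
  apply: bb; rewrite -bE in hf' *; apply/seteqP.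
  have ff u : ~ near b u -> f u = f' u.
    move=> nu; rewrite -hf // -hf' //; apply/eqP; apply: contrapT => /negP; rewrite eq_sym => /fk uk.
    by apply: nu; exists (pos h).
  by split=> g [gb gf]; split=> // u nu; rewrite gf // ff.
Qed.

Lemma Gamma_asdim : asdim (word_dist R (gsub_gens gamma_gens)) = 2%:E.
Proof.
apply/le_anti/andP; split.
  by apply: ereal_inf_lbound; exists 2%N => //; exact: Gamma_asdim_le2.
apply: le_ereal_inf_tmp => _ [k /Gamma_asdim_ge k2 <-].
by rewrite lee_fin ler_nat.
Qed.

Lemma Lambda_asdim : asdim (word_dist R (gsub_gens lambda_gens)) = +oo%E.
Proof.
rewrite /asdim (_ : asdim_le _ = set0) ?image_set0 ?ereal_inf0 //.
by apply/seteqP; split=> // k /Lambda_asdim_le.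
Qed.

End Asdim.

(** * The Bernoulli measure *)

Definition cyl (L : seq site) (y : config) : set config := [set x : config | {in L, x =1 y}].

Lemma cyl_sub L M x y : {subset L <= M} -> cyl L y x -> cyl M x `<=` cyl L y.
Proof. by move=> LM yx w xw u uL; rewrite xw ?yx // LM. Qed.

Definition pattern (L : seq site) (w : seq bool) : set config := [set x : config | map x L = w].

Lemma pattern_cyl L y : pattern L (map y L) = cyl L y.
Proof. by apply/seteqP; split=> x /= => [/eq_in_map|/eq_in_map]. Qed.

Lemma box_sites_le k l : (k <= l)%N -> {subset box_sites k <= box_sites l}.
Proof.
by move=> kl u /box_sitesP[u1 u2]; apply/box_sitesP; split; exact: leq_trans kl.
Qed.

Lemma sub_box_sites (L : seq site) : exists k, {subset L <= box_sites k}.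
Proof.
elim: L => [|u L [k Hk]]; first by exists 0%N.
exists (k + (absz u.1 + absz u.2))%N => v; rewrite inE => /orP[/eqP->|/Hk].
  by apply/box_sitesP; split; lia.
by apply: box_sites_le; exact: leq_addr.
Qed.

(** Over nested boxes two cylinders are comparable or disjoint, so with the empty set they are
    closed under intersection. *)
Definition cylinders : set (set config) :=
  [set A | A = set0 \/ exists k y, A = cyl (box_sites k) y].

HB.instance Definition _ := gen_eqMixin config.
HB.instance Definition _ := gen_choiceMixin config.
HB.instance Definition _ := isPointed.Build config (fun=> false).

(** * The Polish topology of the configuration space *)

Section Topology.
Variable R : realType.

Definition config_space (_ : realType) : Type := config.
Local Notation T := (config_space R).

HB.instance Definition _ := Pointed.copy T config.

Definition site_norm (u : site) : nat := maxn (absz u.1) (absz u.2).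

(** Closeness up to [e] means agreement at all sites of norm at most [1 / e - 1]; the ball of radius
    [1 / (k + 1)] is the cylinder over the box of radius [k]. *)
Definition config_ball (x : T) (e : R) : set T :=
  [set y | 0 < e /\ forall u, e <= (site_norm u).+1%:R^-1 -> x u = y u].

Let ent : set_system (T * T) := entourage_ config_ball.
HB.instance Definition _ := hasNbhs.Build T (nbhs_ ent).
Let nbhsE : (nbhs : T -> set_system T) = nbhs_ ent. Proof. by []. Qed.

Let ball_center x (e : R) : 0 < e -> config_ball x e x.
Proof. by []. Qed.

Let ball_sym x y (e : R) : config_ball x e y -> config_ball y e x.
Proof. by move=> [e0 xy]; split=> // u /xy. Qed.

Let ball_triangle x y w e1 e2 : config_ball x e1 y -> config_ball y e2 w ->
  config_ball x (e1 + e2) w.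
Proof.
move=> [e10 xy] [e20 yw]; split; first exact: addr_gt0.
move=> u ue; rewrite xy ?yw //; apply: le_trans ue; first by rewrite lerDr ltW.
by rewrite lerDl ltW.
Qed.

Let entE : ent = entourage_ config_ball. Proof. by []. Qed.

HB.instance Definition _ := @Nbhs_isPseudoMetric.Build R T
  ent nbhsE config_ball ball_center ball_sym ball_triangle entE.

Lemma config_ballE (x : T) (e : R) : ball x e = config_ball x e. Proof. by []. Qed.

Lemma ball_cyl (x : T) k : ball x (k.+1%:R^-1 : R) = cyl (box_sites k) x.
Proof.
have ke u : (k.+1%:R^-1 <= (site_norm u).+1%:R^-1 :> R) = (u \in box_sites k).
  rewrite lef_pV2 ?posrE // ler_nat ltnS geq_max.
  by apply/andP/box_sitesP.
rewrite config_ballE; apply/seteqP; split=> y /=.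
  by move=> [_ xy] u uk; rewrite xy ?ke.
by move=> xy; split=> // u; rewrite ke => /xy.
Qed.

Lemma nbhs_cyl (x : T) (A : set T) :
  nbhs x A <-> exists k, cyl (box_sites k) x `<=` A.
Proof.
rewrite -nbhs_ballE; split=> [[e /= e0 eA]|[k kA]].
  pose k := Num.bound e^-1; exists k; rewrite -ball_cyl; apply: subset_trans eA.
  apply: le_ball; rewrite -[e]invrK lef_pV2 ?posrE ?invr_gt0 //.
  apply/ltW/(lt_le_trans (archi_boundP _)); first by rewrite invr_ge0 ltW.
  by rewrite ler_nat leqW.
by exists k.+1%:R^-1; rewrite //= ?ball_cyl.
Qed.

Lemma config_cauchy_cvg (F : set_system T) : ProperFilter F -> cauchy F -> cvg F.
Proof.
move=> FF /cauchy_ballP Fc.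
pose y : T := fun u => `[< F [set x : T | x u = true] >].
suff : F --> y by move/cvgP.
move=> A /nbhs_cyl[k kA].
have k0 : 0 < k.+1%:R^-1 :> R by rewrite invr_gt0.
have [[P Q] /= [FP FQ] PQ] := Fc _ k0; have [a Qa] := filter_ex FQ.
have Fa : F (cyl (box_sites k) a).
  apply: filterS FP => x Px; have := PQ (x, a) (conj Px Qa) => /=.
  by rewrite ball_cyl => xa u /xa ->.
have ya : {in box_sites k, y =1 a}.
  move=> u uk; apply/asboolP/idP => [Fu|au]; last first.
    by apply: filterS Fa => x xa /=; rewrite xa.
  have [x [/= xu xa]] := filter_ex (filterI Fu Fa).
  by rewrite -(xa u uk) xu.
by apply: filterS Fa => x xa; apply: kA => u uk; rewrite xa // ya.
Qed.

HB.instance Definition _ := Uniform_isComplete.Build T config_cauchy_cvg.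

Lemma config_hausdorff : hausdorff_space T.
Proof.
move=> x y xy; apply/funext => u.
have [k Lk] := sub_box_sites [:: u].
have [] := xy (cyl (box_sites k) x) (cyl (box_sites k) y).
- by apply/nbhs_cyl; exists k.
- by apply/nbhs_cyl; exists k.
- by move=> w [xw yw]; rewrite -xw ?yw // Lk ?mem_head.
Qed.

Lemma cyl_open k (y : T) : open (cyl (box_sites k) y : set T).
Proof.
rewrite openE => x yx; apply/nbhs_cyl; exists k.
exact: cyl_sub.
Qed.

Lemma config_second_countable : @second_countable T.
Proof.
exists [set A : set T | exists k y, A = cyl (box_sites k) y].
  apply: (@sub_countable _ _ _ [set pattern (box_sites kw.1) kw.2 | kw in [set: nat * seq bool]]).
    apply: subset_card_le => A [k [y ->]]; exists (k, map y (box_sites k)) => //.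
    by rewrite pattern_cyl.
  exact: sub_countable (card_image_le _ _) (countableP _).
split=> [A [k [y ->]]|x A /nbhs_cyl[k kA]]; first exact: cyl_open.
by exists (cyl (box_sites k) x) => //; split; [exists k, x|].
Qed.

End Topology.

Definition meas_config := g_sigma_algebraType cylinders.

Lemma measurable_local k (A : set meas_config) :
  (forall x y, {in box_sites k, x =1 y} -> A x -> A y) -> measurable A.
Proof.
move=> Aloc.
rewrite (_ : A = \bigcup_(w : seq bool) (if `[< exists x, A x /\ map x (box_sites k) = w >]
                                        then pattern (box_sites k) w else set0)).
  apply: countable_bigcupT_measurable => // w; case: asboolP => [[x [_ <-]]|_] //.
  by rewrite pattern_cyl; apply: sub_sigma_algebra; right; exists k, x.
apply/seteqP; split=> [x Ax|x [w _]].
  exists (map x (box_sites k)) => //; case: asboolP => // nx.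
  by apply: nx; exists x.
case: asboolP => // -[y [Ay <-]]; rewrite pattern_cyl => xy.
by apply: Aloc Ay => u uk; rewrite xy.
Qed.

Lemma measurable_cyl L y : measurable (cyl L y : set meas_config).
Proof.
have [k Lk] := sub_box_sites L; apply: (@measurable_local k) => x x' xx' yx u uL.
by rewrite -xx' ?yx // Lk.
Qed.

Lemma meas_config_standard (R : realType) : standard_borel R meas_config.
Proof.
exists (config_space R), idfun; split.
- exact: config_hausdorff.
- exact: config_second_countable.
- by exists idfun.
- move=> A; rewrite image_id; split; last first.
    apply: smallest_sub; first exact: sigma_algebra_measurable.
    move=> O; rewrite openE => Oo.
    rewrite (_ : O = \bigcup_k [set x : meas_config | cyl (box_sites k) x `<=` O]).
      apply: bigcup_measurable => k _; apply: (@measurable_local k) => x y xy xO.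
      by apply: subset_trans xO => w yw u uk; rewrite yw ?xy.
    apply/seteqP; split=> [x /Oo /nbhs_cyl[k kO]|x [k _ kO]]; first by exists k.
    exact: kO.
- apply: smallest_sub; first exact: smallest_sigma_algebra.
  move=> _ [->|[k [y ->]]]; first exact: sigma_algebra0.
  by apply: sub_sigma_algebra; exact: cyl_open.
Qed.

(** * Binary digits of a real number *)

Section Bits.
Variable R : realType.
Implicit Types r : R.

(** The doubling map of [[0, 1)]: a binary digit of [r] tells on which side of [1/2] the
    corresponding iterate lies. *)
Definition doubling r : R := if r < 2^-1 then 2 * r else 2 * r - 1.

Definition bit (j : nat) r : bool := 2^-1 <= iter j doubling r.

Lemma measurable_doubling : measurable_fun [set: R] doubling.
Proof.
apply: measurable_fun_ifT.
- exact: measurable_fun_ltr.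
- exact: measurable_funM.
- by apply: measurable_funB => //; exact: measurable_funM.
Qed.

Lemma measurable_iter_doubling j : measurable_fun [set: R] (iter j doubling).
Proof.
by elim: j => [|j IH]; [exact: measurable_id|exact: (measurableT_comp measurable_doubling IH)].
Qed.

Lemma measurable_bit j : measurable_fun [set: R] (bit j).
Proof. by apply: measurable_fun_ler => //; exact: measurable_iter_doubling. Qed.

(** Prescribing one more leading digit pulls the interval back along a branch of the doubling map,
    so [a] becomes [(a + w 0) / 2]. *)
Lemma dyadic_cylinder n (w : nat -> bool) : exists a : R, [/\ 0 <= a, a + 2^-1 ^+ n <= 1 &
  [set r | 0 <= r < 1 /\ forall j, (j < n)%N -> bit j r = w j] = `[a, a + 2^-1 ^+ n[%classic].
Proof.
elim: n w => [|n IH] w.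
  exists 0; rewrite expr0 add0r; split=> //; apply/seteqP; split=> r /=; rewrite in_itv /=.
    by case.
  by split.
have [a [a0 a1 E]] := IH (w \o S); exists ((a + (w 0%N)%:R) / 2).
have e0 : 0 < (2^-1 : R) ^+ n by rewrite exprn_gt0.
have wE : (w 0%N)%:R = 0 :> R /\ w 0%N = false \/ (w 0%N)%:R = 1 :> R /\ w 0%N = true.
  by case: (w 0%N); [right|left].
split; rewrite ?exprS.
- by rewrite divr_ge0 // addr_ge0 ?ler0n.
- by case: wE => -[-> _]; lra.
have key r : 0 <= r < 1 -> (forall j, (j < n.+1)%N -> bit j r = w j) <->
    bit 0 r = w 0%N /\ `[a, a + 2^-1 ^+ n[%classic (doubling r).
  move=> r01; rewrite -E; split=> [H|[h0 [_ H]] [|j] jn]; last 2 first.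
  - exact: h0.
  - by rewrite /bit iterSr; exact: H.
  split; first exact: H.
  split; last by move=> j jn; have := H j.+1 jn; rewrite /bit iterSr.
  by rewrite /doubling; case: ltP => r2; lra.
apply/seteqP; split=> r.
  move=> [r01 /(key r r01)[]]; rewrite /bit /doubling /= !in_itv /=.
  by case: wE => -[-> ->]; case: ltP => // r2; [|] => h1 h2; lra.
rewrite /= in_itv /= => rI.
have r01 : 0 <= r < 1 by case: wE rI => -[-> _] rI; lra.
split => //; apply/(key r r01); rewrite /bit /doubling /= in_itv /=.
case: wE rI => -[-> ->] rI.
  have r2 : r < 2^-1 by lra.
  by rewrite r2 leNgt r2; split=> //; lra.
have r2 : 2^-1 <= r by lra.
by rewrite r2 ltNge r2 /=; split=> //; lra.
Qed.

End Bits.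

Section BernoulliMeasure.
Variable R : realType.

(* The digits of a uniform point of [0, 1) are independent fair bits. *)
Definition unit_prob : set (measurableTypeR R) -> \bar R :=
  mrestr lebesgue_measure (measurable_itv `[(0 : R), 1[).

HB.instance Definition _ := Measure.on unit_prob.

Let unit_probT : unit_prob [set: R] = 1%E.
Proof. by rewrite /unit_prob /mrestr setTI lebesgue_measure_itv /= lte_fin ltr01 oppr0 adde0. Qed.

HB.instance Definition _ := Measure_isProbability.Build _ _ R unit_prob unit_probT.

Definition bits_event (I : seq nat) (w : nat -> bool) : set R :=
  [set r | forall j, j \in I -> bit j r = w j].

Lemma measurable_bits_event I w : measurable (bits_event I w).
Proof.
elim: I => [|j I IH]; first by rewrite (_ : bits_event _ _ = setT) //; apply/seteqP.
rewrite (_ : bits_event _ _ = (bit j @^-1` [set w j]) `&` bits_event I w).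
  by apply: measurableI => //; rewrite -[X in measurable X]setTI; exact: measurable_bit.
apply/seteqP; split=> [r H|r [rj rI] i].
  by split=> [|i iI]; apply: H; rewrite inE ?eqxx // iI orbT.
by rewrite inE => /orP[/eqP->|/rI].
Qed.

Lemma bits_event_full n w : unit_prob (bits_event (iota 0 n) w) = ((2^-1 : R) ^+ n)%:E.
Proof.
have [a [_ _ E]] := dyadic_cylinder R n w.
rewrite /unit_prob /mrestr.
have -> : bits_event (iota 0 n) w `&` `[0, 1[%classic = `[a, a + 2^-1 ^+ n[%classic.
  rewrite -E; apply/seteqP; split=> r /=; rewrite in_itv /=.
    by move=> [H r01]; split=> // j jn; apply: H; rewrite mem_iota.
  by move=> [r01 H]; split=> // j; rewrite mem_iota => /H.
rewrite lebesgue_measure_itv /= lte_fin ltrDl exprn_gt0 //.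
by rewrite -EFinD addrAC subrr add0r.
Qed.

(** For an initial segment of indices the event is a dyadic interval. Otherwise a missing index [j]
    is adjoined and the event split by the value of its bit; the induction is on the number of
    indices missing below [N]. *)
Lemma bits_event_prob (I : seq nat) w : uniq I ->
  unit_prob (bits_event I w) = ((2^-1 : R) ^+ size I)%:E.
Proof.
move=> uI; have [N IN] : exists N, forall j, j \in I -> (j < N)%N.
  exists (\max_(j <- I) j).+1 => j jI; rewrite ltnS.
  by rewrite (leq_bigmax_seq j).
move Ek : (N - size I)%N => k.
elim: k I w uI IN Ek => [|k IH] I w uI IN Ek.
  have sN : (size I <= N)%N.
    rewrite -[leqRHS](size_iota 0); apply: uniq_leq_size => // j /IN.
    by rewrite mem_iota.
  have II : I =i iota 0 N.
    have sub : {subset I <= iota 0 N} by move=> j /IN; rewrite mem_iota.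
    have le : (size (iota 0 N) <= size I)%N by rewrite size_iota -subn_eq0 Ek.
    by have [] := uniq_min_size uI sub le.
  have -> : bits_event I w = bits_event (iota 0 N) w.
    by apply/seteqP; split=> r H j; [rewrite -II|rewrite II]; exact: H.
  rewrite bits_event_full (_ : N = size I) //; lia.
have [j jN jI] : exists2 j, (j < N)%N & j \notin I.
  apply: contrapT => noj.
  have : (size (iota 0 N) <= size I)%N.
    apply: uniq_leq_size; first exact: iota_uniq.
    move=> j; rewrite mem_iota => /andP[_ jN]; apply: contrapT => /negP jI.
    by apply: noj; exists j.
  by rewrite size_iota; lia.
pose w' b i := if i == j then b else w i.
have split_event : bits_event I w = bits_event (j :: I) (w' true) `|` bits_event (j :: I) (w' false).
  have ww b i : i \in I -> w' b i = w i.
    by rewrite /w'; case: eqP => // -> iI; rewrite iI in jI.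
  apply/seteqP; split=> [r rI|r [] H i iI]; last 2 first.
  - by rewrite H ?ww // inE iI orbT.
  - by rewrite H ?ww // inE iI orbT.
  have Hb : bits_event (j :: I) (w' (bit j r)) r.
    by move=> i; rewrite inE => /orP[/eqP->|iI]; [rewrite /w' eqxx|rewrite ww // rI].
  by case: (bit j r) Hb; [left|right].
have sumE : unit_prob (bits_event I w) =
    (unit_prob (bits_event (j :: I) (w' true)) + unit_prob (bits_event (j :: I) (w' false)))%E.
  rewrite split_event measureU //; [exact: measurable_bits_event|exact: measurable_bits_event|].
  apply/seteqP; split=> // r [H1 H2].
  have := H1 j (mem_head _ _); rewrite (H2 j (mem_head _ _)) /w' eqxx //.
have uj : uniq (j :: I) by rewrite /= jI.
have jIN i : i \in j :: I -> (i < N)%N by rewrite inE => /orP[/eqP->|/IN].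
have Ek' : (N - size (j :: I))%N = k by rewrite /=; lia.
rewrite sumE !IH //=.
by rewrite -EFinD exprS; congr (_%:E); lra.
Qed.

(** The codes of a set of sites need not form an initial segment, which is why independence is
    established for arbitrary finite sets of digits. *)
Definition random_config (r : measurableTypeR R) : meas_config := fun u => bit (choice.pickle u) r.

Definition site_bits (y : config) (j : nat) : bool :=
  if choice.unpickle j is Some u then y u else false.

Lemma preimage_cyl L y : random_config @^-1` (cyl L y) = bits_event (map choice.pickle L) (site_bits y).
Proof.
apply/seteqP; split=> [r H _ /mapP[u uL ->]|r H u uL].
  by rewrite /site_bits choice.pickleK -H.
by have := H _ (map_f _ uL); rewrite /site_bits choice.pickleK.
Qed.

Lemma measurable_random_config : measurable_fun [set: measurableTypeR R] random_config.
Proof.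
apply: (@measurability _ _ (measurableTypeR R) meas_config setT random_config cylinders) => // _ [_ [->|[k [y ->]]] <-].
  by rewrite preimage_set0 setI0.
by rewrite setTI preimage_cyl; exact: measurable_bits_event.
Qed.

HB.instance Definition _ := isMeasurableFun.Build _ _ _ _ random_config measurable_random_config.

Lemma bernoulli_measure : exists mu : probability meas_config R,
  forall L y, uniq L -> mu (cyl L y) = ((2^-1 : R) ^+ size L)%:E.
Proof.
exists (distribution unit_prob random_config) => L y uL.
rewrite /= /distribution /pushforward preimage_cyl.
by rewrite bits_event_prob ?size_map // map_inj_uniq.
Qed.

End BernoulliMeasure.

(** * Invariance of the measure, and genericity almost everywhere *)

Section Preservation.
Variable R : realType.
Variable mu : probability meas_config R.
Hypothesis bernoulli_cyl : forall L y, uniq L -> mu (cyl L y) = ((2^-1 : R) ^+ size L)%:E.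

(** The bits of [g x] on a box and those of [x] on [F] determine each other, so the preimage of a
    cylinder is a cylinder on equally many sites and has the same Bernoulli measure. *)
Definition cylinder_preserving (g : sym config) := forall k,
  exists F : seq site, [/\ uniq F, size F = size (box_sites k) &
    forall x y, {in box_sites k, g x =1 g y} <-> {in F, x =1 y}].

Lemma preimage_cylinder (g : sym config) k (F : seq site) w :
  (forall x y, {in box_sites k, g x =1 g y} <-> {in F, x =1 y}) ->
  g @^-1` (cyl (box_sites k) w) = cyl F (sym_inv g w).
Proof.
move=> gF; apply/seteqP; split=> x /=.
  by move=> xw; apply/gF; rewrite sym_invK.
by move/gF; rewrite sym_invK.
Qed.

Lemma cylinders_setI : setI_closed cylinders.
Proof.
move=> S S' [->|[k [y ->]]]; first by rewrite set0I; left.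
case=> [->|[l [w ->]]]; first by rewrite setI0; left.
wlog kl : k l y w / (k <= l)%N.
  move=> H; case: (leqP k l) => [|/ltnW] /H; first exact.
  by rewrite setIC; apply.
have [[x [yx wx]]|no] := pselect (exists x, cyl (box_sites k) y x /\ cyl (box_sites l) w x).
  right; exists l, w; apply/setIidr.
  apply: (cyl_sub (box_sites_le kl)) => u uk.
  by rewrite -wx ?yx // (box_sites_le kl).
left; apply/seteqP; split=> // x [yx wx]; by apply: no; exists x.
Qed.

Lemma cylinder_preserving_measurable g : cylinder_preserving g ->
  measurable_fun [set: meas_config] (g : meas_config -> meas_config).
Proof.
move=> gP; apply: (@measurability _ _ meas_config meas_config setT g cylinders) => //.
move=> _ [_ [->|[k [y ->]]] <-]; first by rewrite preimage_set0 setI0.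
have [F [_ _ gF]] := gP k.
by rewrite setTI (preimage_cylinder _ gF); exact: measurable_cyl.
Qed.

Definition pmp (g : sym config) : Prop :=
  @measure_preserving R _ meas_config mu g.

Lemma cylinder_preserving_pmp g : cylinder_preserving g -> pmp g.
Proof.
move=> gP; have mg := cylinder_preserving_measurable gP; split=> // A mA.
pose g' : {mfun meas_config >-> meas_config} := mfun_Sub (mem_set mg).
have -> : mu (g @^-1` A) = distribution mu g' A by [].
(* Uniqueness asks for a countable cover by generators of finite measure; the two cylinders over the
   single site of [box_sites 0], indexed by parity, provide it. *)
apply: (@g_sigma_algebra_measure_unique _ R meas_config cylinders _ (fun n => cyl (box_sites 0) (fun=> odd n))) => //.
- exact: sub_sigma_algebra.
- by move=> n; right; exists 0%N, (fun=> odd n).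
- apply/seteqP; split=> // x _; exists (x 0 : nat) => //.
  move=> u /box_sitesP[u1 u2]; rewrite oddb; congr (x _).
  by case: u u1 u2 => a b /=; rewrite !leqn0 !absz_eq0 => /eqP-> /eqP->.
- exact: cylinders_setI.
- move=> _ [->|[k [y ->]]]; first by rewrite !measure0.
  have [F [uF sF gF]] := gP k.
  transitivity (mu (g @^-1` cyl (box_sites k) y)); first by [].
  rewrite (preimage_cylinder _ gF) bernoulli_cyl // sF; exact/esym/bernoulli_cyl/box_sites_uniq.
- by move=> k; rewrite (le_lt_trans (probability_le1 _ _)) ?ltry //; exact: measurable_cyl.
Qed.

Lemma measure_preservingM (g h : sym config) :
  pmp g -> pmp h ->
  pmp (g * h)%g.
Proof.
move=> [mg gP] [mh hP]; split; first exact: measurableT_comp mg mh.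
move=> A mA; rewrite -[RHS](gP _ mA) -[RHS]hP //.
by rewrite -[X in measurable X]setTI; exact: mg.
Qed.

Lemma flip_pmp z : pmp (flip z).
Proof.
apply: cylinder_preserving_pmp => k; exists (box_sites k); split=> [||x y] //; first exact: box_sites_uniq.
by split=> xy u uk; have := xy u uk; rewrite !flipE; [move/addIb|move=> ->].
Qed.

Lemma transl_pmp p : pmp (transl p).
Proof.
apply: cylinder_preserving_pmp => k; exists [seq u - p | u <- box_sites k]; split=> [||x y].
- by rewrite map_inj_uniq ?box_sites_uniq //; exact: addIr.
- by rewrite size_map.
- split=> [xy _ /mapP[u uk ->]|xy u uk]; first exact: xy.
  by rewrite !translE; apply: xy; apply/mapP; exists u.
Qed.

(** A bit on the upward ray from [0] depends on the bits between [0] and itself, which lie in the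
    same box. The inverse odometer gives the converse, so [F] is the box. *)
Lemma odo_pmp c : pmp (odo_sign c 0).
Proof.
have loc c' k x y : {in box_sites k, x =1 y} -> {in box_sites k, odo_fun c' 0 x =1 odo_fun c' 0 y}.
  move=> xy u uk; case: (boolP (on_ray 0 u)) => u0; last by rewrite !odo_off // xy.
  apply: odo_fun_local => v; rewrite inE => /orP[/eqP->|/mapP[m]]; first exact: xy.
  rewrite mem_iota /= => mu' ->; apply: xy; case/box_sitesP: uk => u1 u2.
  by apply/box_sitesP; rewrite /box /up /=; lia.
apply: cylinder_preserving_pmp => k; exists (box_sites k); split=> [||x y] //; first exact: box_sites_uniq.
split=> [xy|xy u uk]; last by rewrite !odo_signE; exact: (loc c k x y xy u uk).
have := @loc (~~ c) k (odo_fun c 0 x) (odo_fun c 0 y); rewrite !odo_funK; apply.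
by move=> u uk; rewrite -!odo_signE xy.
Qed.

Lemma reach_pmp a k g : (forall s, sym_gens [:: a; transl (1, 0); transl (0, 1)] s ->
    pmp s) ->
  reach (sym_gens [:: a; transl (1, 0); transl (0, 1)]) k g ->
  pmp g.
Proof.
move=> HS; move=> /(@reach_ind _ _ (fun _ g => pmp g)) [||l _ //].
  by rewrite -transl0; exact: transl_pmp.
by move=> {k}k s h /HS sP hP; exact: measure_preservingM.
Qed.

Lemma gamma_pmp k g : reach (sym_gens gamma_gens) k g ->
  pmp g.
Proof.
by apply: reach_pmp => s /gamma_gensP[->|[e _ ->]]; [exact: flip_pmp|exact: transl_pmp].
Qed.

Lemma lambda_pmp k g : reach (sym_gens lambda_gens) k g ->
  pmp g.
Proof.
apply: reach_pmp => s /lambda_gensP[->|->|[e _ ->]]; last exact: transl_pmp.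
- exact: (odo_pmp true).
- exact: (odo_pmp false).
Qed.

Definition constant_run z p (n : nat) : set config :=
  [set x : config | forall m, (m <= n)%N -> x (z + p *+ m) = x z].

Lemma measurable_constant_run z p n : measurable (constant_run z p n : set meas_config).
Proof.
have [k Hk] := sub_box_sites [seq z + p *+ m | m <- iota 0 n.+1].
have mem m : (m <= n)%N -> z + p *+ m \in box_sites k.
  by move=> mn; apply: Hk; apply/mapP; exists m; rewrite ?mem_iota.
have zk : z \in box_sites k by rewrite -[z]addr0 -(mulr0n p) mem.
by apply: (@measurable_local k) => x y xy xr m mn; rewrite -!xy ?xr // mem.
Qed.

Lemma constant_run_prob z p n : p != 0 -> mu (constant_run z p n) = ((2^-1 : R) ^+ n)%:E.
Proof.
move=> p0; pose L := [seq z + p *+ m | m <- iota 0 n.+1].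
have uL : uniq L.
  by rewrite map_inj_uniq ?iota_uniq // => i j /addrI; exact: mulrn_site_inj.
have zL : z \in L by apply/mapP; exists 0%N; rewrite // mulr0n addr0.
have -> : constant_run z p n = cyl L (fun=> true) `|` cyl L (fun=> false).
  apply/seteqP; split=> [x xr|x [] xL m mn].
  - have xz : {in L, forall u, x u = x z}.
      by move=> u /mapP[m]; rewrite mem_iota => mn ->; exact: xr.
    by case: (x z) xz => xz; [left|right].
  - by rewrite !xL //; apply/mapP; exists m; rewrite ?mem_iota.
  - by rewrite !xL //; apply/mapP; exists m; rewrite ?mem_iota.
have -> : mu (cyl L (fun=> true) `|` cyl L (fun=> false)) =
    (mu (cyl L (fun=> true)) + mu (cyl L (fun=> false)))%E.
  rewrite measureU //; [exact: measurable_cyl|exact: measurable_cyl|].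
  by apply/seteqP; split=> // x [x1 x2]; have := x1 z zL; rewrite x2.
rewrite !bernoulli_cyl // size_map size_iota -EFinD exprS; congr (_%:E); lra.
Qed.

Lemma constant_ray_negligible z p : p != 0 -> mu.-negligible (\bigcap_n constant_run z p n).
Proof.
have mC : measurable (\bigcap_n constant_run z p n : set meas_config).
  by apply: bigcapT_measurable => n; exact: (measurable_constant_run z p n).
move=> p0; exists (\bigcap_n constant_run z p n); split=> //.
apply/eqP; rewrite eq_le measure_ge0 andbT; apply/lee_addgt0Pr => e e0; rewrite add0e.
have half : `|2^-1 : R| < 1 by rewrite ger0_norm; lra.
have /cvgrPdist_lt/(_ _ e0)[n _ /= /(_ n (leqnn n)) ne] := @cvg_geometric R 1 2^-1 half.
apply: (@le_trans _ _ (mu (constant_run z p n))).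
  apply: le_measure; [exact: mem_set| |exact: bigcap_inf].
  exact: (mem_set (measurable_constant_run _ _ _)).
rewrite constant_run_prob // lee_fin ltW //.
by apply: le_lt_trans ne; rewrite sub0r normrN mul1r; exact: ler_norm.
Qed.

(** There are countably many pairs [(z, p)], and for [p != 0] an endless constant run has measure
    zero, being contained in runs of probability [2^-n]. *)
Lemma ae_good (P : meas_config -> Prop) :
  (forall x, good x -> P x) -> {ae mu, forall x, P x}.
Proof.
move=> goodP.
pose bad (n : nat) : set meas_config :=
  if choice.unpickle n is Some zp then
    if (zp : site * site).2 != 0 then \bigcap_n constant_run zp.1 zp.2 n else set0
  else set0.
change (mu.-negligible (~` [set x | P x])).
apply: (@negligibleS _ _ _ mu (\bigcup_n bad n)); last first.
  apply: negligible_bigcup => n; rewrite /bad; case: choice.unpickle => [[z p]|] /=; last exact: negligible_set0.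
  by case: ifP => [|_]; [exact: constant_ray_negligible|exact: negligible_set0].
move=> x /= nPx; have ngx : ~ good x by move=> /goodP.
have [z [p [p0 xr]]] : exists z p, p != 0 /\ forall m, x (z + p *+ m) = x z.
  apply: contrapT => no; apply: ngx => z p p0; apply: contrapT => nom.
  apply: no; exists z, p; split=> // m; apply/eqP; apply: contrapT => /negP xm.
  by apply: nom; exists m.
have badE : bad (choice.pickle (z, p)) = \bigcap_n constant_run z p n.
  by rewrite /bad choice.pickleK /= p0.
exists (choice.pickle (z, p)); first exact: I.
by rewrite badE => m _ k _; exact: xr.
Qed.

End Preservation.

(** * Exponential integrability of the coupling *)

(* Unlike [ge0_le_integral], this requires no measurability: the integral of a
   nonnegative function is a supremum over the simple functions below it. *)
Lemma ge0_le_integral_sup d (T : measurableType d) (R : realType)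
    (mu : {measure set T -> \bar R}) (f g : T -> \bar R) :
  (forall t, 0 <= f t)%E -> (forall t, f t <= g t)%E ->
  (\int[mu]_t f t <= \int[mu]_t g t)%E.
Proof.
move=> f0 fg; have g0 t : (0 <= g t)%E := le_trans (f0 t) (fg t).
rewrite !ge0_integralTE //; apply: ereal_sup_le => _ [h hf <-].
by exists h => // t; exact: le_trans (hf t) (fg t).
Qed.

Section Integrability.
Variable R : realType.
Variable mu : probability meas_config R.
Hypothesis bernoulli_cyl : forall L y, uniq L -> mu (cyl L y) = ((2^-1 : R) ^+ size L)%:E.

(* [F] is an integrable bound for [exp (d (x, g x) / c)], where [d] is the word
   distance along the orbits of the group generated by [gens]; it is infinite
   where [g x] may leave the orbit of [x]. *)
Definition exp_dominated (gens : seq (sym config)) (g : sym config) : Prop :=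
  exists (c : R) (F : meas_config -> \bar R), [/\ 0 < c, measurable_fun setT F,
    forall x, (0 <= F x)%E, (\int[mu]_x F x < +oo)%E &
    forall x, (F x < +oo)%E -> exists n (h : sym config),
      [/\ reach (sym_gens gens) n h, h x = g x & ((expR (n%:R / c))%:E <= F x)%E]].

Lemma exp_dominated_reach (gens : seq (sym config)) k (g : sym config) :
  (forall x, exists2 h : sym config, reach (sym_gens gens) k h & h x = g x) -> exp_dominated gens g.
Proof.
move=> H; exists 1, (cst (expR (k%:R / 1))%:E); split=> //.
- by move=> x; rewrite lee_fin expR_ge0.
- by rewrite integral_cst // [X in (_ * X)%E](probability_setT mu) mule1 ltry.
- by move=> x _; have [h hk hx] := H x; exists k, h.
Qed.

(** This passes from generators to words. The bound for [g] is evaluated at [h x], and as [h]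
    preserves [mu] its integral does not change. *)
Lemma exp_dominatedM gens g h : pmp mu h ->
  exp_dominated gens g -> exp_dominated gens h -> exp_dominated gens (g * h)%g.
Proof.
move=> [mh hP] [c [F [c0 mF F0 intF FP]]] [c' [F' [c0' mF' F0' intF' FP']]].
pose h' : {mfun meas_config >-> meas_config} := mfun_Sub (mem_set mh).
have intFh : (\int[mu]_x F (h x) = \int[mu]_x F x)%E.
  transitivity (\int[distribution mu h']_x F x)%E; first by rewrite ge0_integral_distribution.
  by apply: eq_measure_integral => A mA _; exact: hP.
have mFh : measurable_fun [set: meas_config] (F \o (h : meas_config -> meas_config)).
  exact: measurableT_comp mF mh.
exists (c + c'), (fun x => F (h x) + F' x)%E; split.
- exact: addr_gt0.
- exact: emeasurable_funD.
- by move=> x; rewrite adde_ge0.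
- rewrite ge0_integralD //= intFh; exact: lte_add_pinfty.
move=> x Fx.
have Fhx : (F (h x) < +oo)%E by apply: le_lt_trans Fx; rewrite leeDl.
have F'x : (F' x < +oo)%E by apply: le_lt_trans Fx; rewrite leeDr.
have [n [a [an ax aF]]] := FP _ Fhx; have [m [b [bm bx bF]]] := FP' _ F'x.
exists (n + m)%N, (a * b)%g; split; first exact: reachM.
  by rewrite !symME bx ax.
(* The mediant of two fractions is at most the larger one. *)
have [nm|mn] := leP (n%:R / c) (m%:R / c').
  apply: (@le_trans _ _ (F' x)); last by rewrite leeDr.
  apply: le_trans bF; rewrite lee_fin ler_expR natrD.
  rewrite ler_pdivrMr ?addr_gt0 // mulrDr divfK ?gt_eqF // lerD2r.
  by rewrite -ler_pdivrMr.
apply: (@le_trans _ _ (F (h x))); last by rewrite leeDl.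
apply: le_trans aF; rewrite lee_fin ler_expR natrD.
rewrite ler_pdivrMr ?addr_gt0 // mulrDr divfK ?gt_eqF // lerD2l.
by rewrite -ler_pdivrMr // ltW.
Qed.

(** Any base strictly between 1 and 2 would serve: below 2 the terms have summable integrals, as the
    [n]-th run has probability [2^-n], and above 1 the sum is infinite on an endless run. *)
Definition run_bound (x : meas_config) : \bar R :=
  (\sum_(0 <= n <oo) ((3 / 2) ^+ n.+1 * \1_(constant_run 0 (0, 1)%R n : set meas_config) x)%:E)%E.

Let run_bound_term_ge0 n x :
  (0 <= ((3 / 2) ^+ n.+1 * \1_(constant_run 0 (0, 1)%R n : set meas_config) x : R)%:E)%E.
Proof. by rewrite lee_fin mulr_ge0 // exprn_ge0 //; lra. Qed.

Let measurable_run_bound_term n : measurable_fun [set: meas_config]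
  (fun x => ((3 / 2) ^+ n.+1 * \1_(constant_run 0 (0, 1)%R n : set meas_config) x : R)%:E).
Proof.
apply/measurable_EFinP/measurable_funM => //.
by apply: measurable_indic; exact: measurable_constant_run.
Qed.

Lemma run_bound_integrable : (\int[mu]_x run_bound x < +oo)%E.
Proof.
(* The bound 6 is [(3/2) / (1 - 3/4)], the sum of the geometric series of the integrals. *)
rewrite /run_bound integral_nneseries // (@le_lt_trans _ _ 6%:E) ?ltry //.
apply: lime_le; first by apply: is_cvg_nneseries => n _ _; exact: integral_ge0.
apply: nearW => N.
have termE n : (\int[mu]_x ((3 / 2) ^+ n.+1 * \1_(constant_run 0 (0, 1)%R n : set meas_config) x : R)%:E =
    ((3 / 2) * (3 / 4) ^+ n : R)%:E)%E.
  under eq_integral do rewrite EFinM.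
  rewrite ge0_integralZl_EFin //; last first.
    by apply/measurable_EFinP/measurable_indic; exact: measurable_constant_run.
  rewrite integral_indic //; last exact: measurable_constant_run.
  rewrite setIT [X in (_ * X)%E](constant_run_prob bernoulli_cyl) // -EFinM; congr (_%:E).
  have -> : 3 / 4 = (3 / 2) * 2^-1 :> R by lra.
  by rewrite [in RHS]exprMn exprS !mulrA.
rewrite (eq_bigr (fun n => ((3 / 2) * (3 / 4) ^+ n : R)%:E)); last by move=> n _; exact: termE.
rewrite sumEFin lee_fin.
have := @geometric_le_lim R N (3 / 2) (3 / 4); rewrite /series /geometric /= => H.
have q1 : `|3 / 4 : R| < 1 by rewrite ger0_norm; lra.
apply: le_trans (H _ _ q1) _; [lra|lra|].
have -> : 1 - 3 / 4 = 4^-1 :> R by lra.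
by rewrite invrK; lra.
Qed.

Lemma measurable_run_bound : measurable_fun [set: meas_config] run_bound.
Proof. exact: ge0_emeasurable_sum. Qed.

Lemma run_bound_ge0 x : (0 <= run_bound x)%E.
Proof. exact: nneseries_ge0. Qed.

Lemma run_bound_ge x n : constant_run 0 (0, 1)%R n x -> (((3 / 2) ^+ n.+1)%:E <= run_bound x)%E.
Proof.
move=> xn; apply: le_trans (nneseries_lim_ge n.+1 _); last by move=> m _ _; exact: run_bound_term_ge0.
rewrite big_nat_recr //= indicE mem_set // mulr1 leeDr //.
by apply: sume_ge0 => m _; exact: run_bound_term_ge0.
Qed.

Lemma odo_exp_dominated c : exp_dominated gamma_gens (odo_sign c 0).
Proof.
have l0 : 0 < ln (3 / 2 : R) by apply: ln_gt0; lra.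
(* A carry stopped after the constant run [N] costs at most [3 * (N + 1) + 1 <= 4 * (N + 1)]
   letters; with this constant the exponential is at most [(3/2)^(N + 1)], a term of the sum. *)
exists (4 / ln (3 / 2)), run_bound; split.
- by rewrite divr_gt0.
- exact: measurable_run_bound.
- exact: run_bound_ge0.
- exact: run_bound_integrable.
move=> x Fx.
have [N xN] : exists N, ~ constant_run 0 (0, 1)%R N x.
  apply: contrapT => noN; move: Fx.
  suff -> : run_bound x = +oo%E by rewrite ltxx.
  apply: eq_infty => r.
  have [n rn] : exists n : nat, r <= (3 / 2) ^+ n.+1.
    (* Two more factors multiply a power that is at least 1 by [9/4], hence add at least 1. *)
    exists (2 * Num.bound `|r|)%N.
    have rb : r < (Num.bound `|r|)%:R by apply: le_lt_trans (ler_norm r) (archi_boundP _).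
    apply: (le_trans (ltW rb)); move: (Num.bound _) => k.
    have -> : 3 / 2 = 1 + 1 / 2 :> R by lra.
    elim: k {rb} => [|k IH]; first by rewrite mulr0n exprn_ge0 //; lra.
    have -> : (2 * k.+1).+1 = ((2 * k).+1 + 2)%N by lia.
    rewrite exprD -natr1 expr2.
    have k1 : 1 <= (1 + 1 / 2 : R) ^+ (2 * k).+1 by apply: exprn_ege1; lra.
    by nra.
  apply: (@le_trans _ _ ((3 / 2) ^+ n.+1)%:E); first by rewrite lee_fin.
  by apply: run_bound_ge; apply: contrapT => xn; apply: noN; exists n.
have exN : exists N, `[< ~ constant_run 0 (0, 1)%R N x >] by exists N; apply/asboolP.
case: (ex_minnP exN) => {N xN} [[|N]] /asboolP xN minN.
  by case: xN => m; rewrite leqn0 => /eqP->; rewrite mulr0n.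
have xN' : constant_run 0 (0, 1)%R N x.
  by apply: contrapT => /asboolP/minN; rewrite ltnn.
have upE m : up 0 m = 0 + (0, 1) *+ m.
  have -> : (0, 1) *+ m = (0, m%:Z) :> site.
    by elim: m => // m IH; rewrite mulrS IH /=; congr (_, _) => /=; lia.
  by rewrite /up add0r /= add0r.
have [g gN gE] : exists2 g, reach (sym_gens gamma_gens) (3 * N.+1 + 1) g & g x = odo_fun c 0 x.
  apply: odo_gamma; case: (eqVneq (x 0) c) => x0; last by exists 0%N; rewrite ?up0.
  apply: contrapT => nom; apply: xN => m mN; apply/eqP; apply: contrapT => /negP xm.
  by apply: nom; exists m; rewrite // upE -x0.
exists (3 * N.+1 + 1)%N, g; split=> //; first by rewrite odo_signE.
apply: le_trans (run_bound_ge xN'); rewrite lee_fin.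
have -> : (3 / 2 : R) ^+ N.+1 = expR (ln (3 / 2) *+ N.+1).
  by rewrite -[ln _ *+ _]mulr_natl expRM_natl lnK // posrE; lra.
rewrite ler_expR invf_div mulrA ler_pdivrMr //.
rewrite -[leLHS]mulrC -[ln _ *+ _]mulr_natr -mulrA ler_pM2l //.
by rewrite -natrM ler_nat; lia.
Qed.

End Integrability.

(** * The coupling and its integrability *)

Definition gsub_act (gens : seq (sym config)) (g : gsub gens) : meas_config -> meas_config := val g.

Section Coupling.
Variable R : realType.
Variable mu : probability meas_config R.
Hypothesis bernoulli_cyl : forall L y, uniq L -> mu (cyl L y) = ((2^-1 : R) ^+ size L)%:E.

Lemma gsub_act_free (gens : seq (sym config)) :
  (forall k g, reach (sym_gens gens) k g -> pmp mu g) ->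
  (forall k g x, reach (sym_gens gens) k g -> good x -> g x = x -> g = 1%g) ->
  free_pmp_action mu (@gsub_act gens).
Proof.
move=> gens_pmp gens_free; split.
- by split=> [x|g h x]; rewrite /gsub_act ?val1 ?valM.
- by move=> g; have [k gk] := reach_gsub g; exact: gens_pmp gk.
- apply: (ae_good bernoulli_cyl) => x gx g gxx; have [k gk] := reach_gsub g.
  by apply: val_inj; rewrite val1; exact: (gens_free k _ x).
Qed.

Lemma coupling : orbit_equivalence_coupling mu (@gsub_act gamma_gens) (@gsub_act lambda_gens).
Proof.
split.
- exact: meas_config_standard.
- apply: gsub_act_free; [exact: (gamma_pmp bernoulli_cyl)|exact: gamma_free].
- apply: gsub_act_free; [exact: (lambda_pmp bernoulli_cyl)|exact: lambda_free].
- apply: (ae_good bernoulli_cyl) => x gx; apply/seteqP; split=> _ [g _ <-].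
    have [k gk] := reach_gsub g; have [h hk hx] := gamma_orbit_lambda x gk.
    by have [h' h'E _] := gsub_reach hk; exists h' => //; rewrite /gsub_act h'E hx.
  have [k gk] := reach_gsub g; have [l [h hl hx]] := lambda_orbit_gamma gk gx.
  by have [h' h'E _] := gsub_reach hl; exists h' => //; rewrite /gsub_act h'E hx.
Qed.

Lemma exp_dominated_integrable (G H : seq (sym config)) :
  (forall g : gsub G, exp_dominated mu H (val g)) ->
  exp_integrable mu (gsub_gens H) (@gsub_act G) (@gsub_act H).
Proof.
move=> dom g; have [c [F [c0 mF F0 intF FP]]] := dom g; exists c => //.
apply: le_lt_trans intF; apply: ge0_le_integral_sup => x; first exact: expeR_ge0.
have [Fx|] := ltP (F x) +oo%E; last by rewrite leye_eq => /eqP->; rewrite leey.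
have [n [h [hn hx hF]]] := FP x Fx; apply: le_trans hF.
rewrite -[(expR _)%:E]/(expeR (n%:R / c)%:E) lee_expeR EFinM.
apply: lee_wpmul2r; first by rewrite lee_fin invr_ge0 ltW.
have [h' h'E h'n] := gsub_reach hn.
apply: (@le_trans _ _ (word_length R (gsub_gens H) h')); last exact: reach_word_length.
by apply: ereal_inf_lbound; exists h' => //=; rewrite /gsub_act h'E hx.
Qed.

Lemma coupling_integrable : exp_exp_integrable mu (gsub_gens gamma_gens) (gsub_gens lambda_gens)
  (@gsub_act gamma_gens) (@gsub_act lambda_gens).
Proof.
split; apply: exp_dominated_integrable => g; have [k gk] := reach_gsub g.
  by apply: (@exp_dominated_reach _ _ _ k) => x; exact: gamma_orbit_lambda.
have transl_dom e : exp_dominated mu gamma_gens (transl e).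
  by apply: (@exp_dominated_reach _ _ _ (absz e.1 + absz e.2)) => x; exists (transl e) => //; exact: reach_transl.
(* The induction carries along that the word preserves [mu], as [exp_dominatedM] demands this of its
   right factor. *)
have [||l _ []//] := @reach_ind _ _ (fun _ g => pmp mu g /\ exp_dominated mu gamma_gens g) _ _ k _ gk.
  by rewrite -transl0; split; [exact: transl_pmp|exact: transl_dom].
move=> l s h sS [hP hD]; split.
  by apply: measure_preservingM => //; apply: (lambda_pmp bernoulli_cyl); exact: reach_gen sS.
apply: exp_dominatedM => //.
have [->|->|[e _ ->]] := lambda_gensP sS; last exact: transl_dom.
- exact: (odo_exp_dominated bernoulli_cyl true).
- exact: (odo_exp_dominated bernoulli_cyl false).
Qed.

End Coupling.

Theorem corollary8p4 (R : realType) :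
  exists (Gamma Lambda : groupType) (SG : set Gamma) (SL : set Lambda),
  [/\ finite_symmetric_generating SG,
      finite_symmetric_generating SL,
      asdim (word_dist R SG) = 2%:E,
      asdim (word_dist R SL) = +oo%E &
      exists (d : measure_display) (X : measurableType d) (mu : probability X R)
             (aG : Gamma -> X -> X) (aL : Lambda -> X -> X),
        orbit_equivalence_coupling mu aG aL /\
        exp_exp_integrable mu SG SL aG aL].
Proof.
exists (gsub gamma_gens), (gsub lambda_gens), (gsub_gens gamma_gens), (gsub_gens lambda_gens).
have [mu muE] := bernoulli_measure R.
split; [exact: gsub_generating|exact: gsub_generating|exact: Gamma_asdim|exact: Lambda_asdim|].
exists _, meas_config, mu, (@gsub_act gamma_gens), (@gsub_act lambda_gens).
by split; [exact: coupling|exact: coupling_integrable].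
Qed.
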